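(* For each $N\in\mathbb{N}$ let $\gamma^{(N)}=(\gamma_1^{(N)},\dots,\gamma_N^{(N)})\in C([a,b];M^N)$ be a stationary point of $\mathcal{A}_N$, and suppose that $\mathcal{A}_N(\gamma^{(N)})\le C$ for some constant $C$ independent of $N$ and that $\gamma^{(N)}(a)\in K_a^N$, $\gamma^{(N)}(b)\in K_b^N$ for all $N$, where $K_a,K_b\subset M$ are compact sets. Let $\pi^{(N)}=\frac1N\sum_{i=1}^N\delta_{\gamma_i^{(N)}}$. Then for a subsequence (not relabeled) $\pi^{(N)}\rightharpoonup\pi$ for some $\pi\in\mathcal{P}(C([a,b];M))$. Furthermore, $\pi$ is supported on $\Gamma_{K_a,K_b}$ (i.e. $\pi(\Gamma_{K_a,K_b})=1$), and there is a Borel measure $\eta$ on $TM$ such that $\pi=\big(\pi_M\phi^L_{\cdot-a}\big)\#\eta$.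
   Context: Let $(M,g)$ be a connected complete Riemannian manifold of class $C^\infty$ with geodesic distance $d_M$, tangent bundle $TM$ and canonical projection $\pi_M:TM\to M$, and let $L:TM\to\mathbb{R}$, $(x,v)\mapsto L(x,v)$, be a Lagrangian satisfying: (1) $L\in C^\infty(TM;\mathbb{R})$; (2) for each compact $K\subset M$ there is a constant $c_0>0$ such that $\nabla_v^2L(x,\cdot)\ge c_0g_x$ for all $x\in K$; (3) there are constants $c_1,c_2>0$ with $L(x,v)\ge c_1|v|-c_2$ for all $(x,v)\in TM$. Fix an interval $[a,b]\subset\mathbb{R}$, $a<b$. For $\gamma\in C([a,b];M)$ set $\mathcal{A}(\gamma)=\int_a^bL(\gamma(t),\dot\gamma(t))\,dt\in(-\infty,+\infty]$ if $\gamma$ is absolutely continuous, and $\mathcal{A}(\gamma)=+\infty$ otherwise. For $\gamma=(\gamma_1,\dots,\gamma_N)\in C([a,b];M^N)$ set $\mathcal{A}_N(\gamma)=\frac1N\sum_{i=1}^N\mathcal{A}(\gamma_i)$. An extremal is a critical point of $\mathcal{A}$ with respect to variations keeping the endpoints fixed, i.e. a smooth curve $\gamma:[a,b]\to M$ solving the Euler–Lagrange equation $\frac{d}{dt}(\nabla_vL)(\gamma(t),\dot\gamma(t))=(\nabla_xL)(\gamma(t),\dot\gamma(t))$. That $\gamma=(\gamma_1,\dots,\gamma_N)$ is a stationary point of $\mathcal{A}_N$ (with fixed endpoints) means that each $\gamma_i$ is an extremal. For $K_1,K_2\subset M$, $\Gamma_{K_1,K_2}$ is the set of extremals $\gamma$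 with $\gamma(a)\in K_1$, $\gamma(b)\in K_2$. The space $C([a,b];M)$ carries the metric $d_\Gamma(\gamma,\gamma')=\sup_{t\in[a,b]}d_M(\gamma(t),\gamma'(t))$; $\mathcal{P}(C([a,b];M))$ is the set of its Borel probability measures, $\rightharpoonup$ denotes weak convergence (testing against bounded continuous functions) and $\#$ denotes push-forward. $\phi^L_t$ denotes the Euler–Lagrange flow on $TM$: if $\gamma$ solves the Euler–Lagrange equation then $(\gamma(t),\dot\gamma(t))=\phi^L_{t-s}(\gamma(s),\dot\gamma(s))$. It is a standing assumption that $\phi^L_t$ is a smooth flow on $TM$, so that the Euler–Lagrange flow mapping $\pi_M\phi^L_{\cdot-a}:TM\to C([a,b];M)$, $(x,v)\mapsto(t\mapsto\pi_M\phi^L_{t-a}(x,v))$, is defined on all of $TM$ and continuous. *)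

(* Defs.v *)
From HB Require Import structures.
From mathcomp Require Import all_boot all_order all_algebra.
From mathcomp Require Import all_classical all_reals all_analysis.
From mathcomp Require Import lra.
Set Implicit Arguments.
Unset Strict Implicit.
Unset Printing Implicit Defensive.
Import Order.TTheory GRing.Theory Num.Theory numFieldNormedType.Exports.
Local Open Scope classical_set_scope.
Local Open Scope ring_scope.

(* In this file V is always finite-dimensional (R, R^n or a product of those);
   there, a map is of class C^oo on an open set U iff all its iterated
   directional derivatives exist and are continuous on U. *)
Definition smooth_on (R : realType) (V W : normedModType R)
    (U : set V) (f : V -> W) : Prop :=
  forall (s : seq V) (x : V), U x ->
    let h := foldr (fun (v : V) (k : V -> W) => 'D_v k) f s in
    {for x, continuous h} /\ (forall v : V, derivable h x v).

(* A smooth n-manifold given by an atlas.  [cinv c] is the inverse of the chart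
   [coord c : dom c -> R^n]; both are total functions, relevant only on [dom c]
   and on its image.  [chart_at x] is a preferred chart around x: it selects the
   coordinates in which tangent vectors at x are stored (see [tangent]).
   Connected manifolds are nonempty, whence the pointed carrier. *)
Record manifold (R : realType) (n : nat) := Manifold {
  mpoint :> ptopologicalType ;
  chart : Type ;
  dom : chart -> set mpoint ;
  coord : chart -> mpoint -> 'rV[R]_n ;
  cinv : chart -> 'rV[R]_n -> mpoint ;
  chart_at : mpoint -> chart ;
  dom_chart_at : forall x, dom (chart_at x) x ;
  dom_open : forall c, open (dom c) ;
  img_open : forall c, open (coord c @` dom c) ;
  coordK : forall c x, dom c x -> cinv c (coord c x) = x ;
  coord_continuous : forall c x, dom c x -> {for x, continuous (coord c)} ;
  cinv_continuous : forall c p, (coord c @` dom c) p ->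
    {for p, continuous (cinv c)} ;
  transition_smooth : forall c d,
    smooth_on (coord c @` (dom c `&` dom d)) (coord d \o cinv c) ;
  mpoint_hausdorff : hausdorff_space mpoint ;
  mpoint_second_countable : @second_countable mpoint }.

Section TangentBundle.
Context {R : realType} {n : nat}.
Implicit Type M : manifold R n.

(* (x, v) is the tangent vector at x whose coordinates in [chart_at x] are v;
   thus T_x M is 'rV[R]_n, with its own vector space structure. *)
Definition tangent M : Type := (M * 'rV[R]_n)%type.

(* The chart of the tangent bundle induced by c: point and vector are both
   expressed in the coordinates of c, vectors through the differential of the
   change of charts. *)
Definition tcoord M (c : chart M) (z : tangent M) : 'rV[R]_n * 'rV[R]_n :=
  (coord c z.1,
   'D_(z.2) (coord c \o cinv (chart_at z.1)) (coord (chart_at z.1) z.1)).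

Definition tinv M (c : chart M) (q : 'rV[R]_n * 'rV[R]_n) : tangent M :=
  (cinv c q.1, 'D_(q.2) (coord (chart_at (cinv c q.1)) \o cinv c) q.1).

Definition timg M (c : chart M) : set ('rV[R]_n * 'rV[R]_n) :=
  (coord c @` dom c) `*` setT.

Lemma timg_open M (c : chart M) : open (timg c).
Proof.
rewrite (_ : timg c = fst @^-1` (coord c @` dom c)).
  by apply: open_comp; [move=> q _; exact: cvg_fst | exact: img_open].
by apply/seteqP; split => q //= [].
Qed.

HB.instance Definition _ M :=
  Choice.copy (tangent M) (M * 'rV[R]_n)%type.
HB.instance Definition _ M :=
  Pointed.copy (tangent M) (M * 'rV[R]_n)%type.

Definition tangent_open M (U : set (tangent M)) : Prop :=
  forall c : chart M, open (timg c `&` tinv c @^-1` U).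

Lemma tangent_openT M : @tangent_open M setT.
Proof.
move=> c; rewrite preimage_setT setIT.
exact: timg_open.
Qed.

Lemma tangent_openI M : setI_closed (@tangent_open M).
Proof.
move=> A B oA oB c; have := openI (oA c) (oB c).
by rewrite setIACA setIid preimage_setI.
Qed.

Lemma tangent_open_bigU M (I : Type) (f : I -> set (tangent M)) :
  (forall i, tangent_open (f i)) -> tangent_open (\bigcup_i f i).
Proof.
move=> of_ c; rewrite preimage_bigcup setI_bigcupr.
by apply: bigcup_open => i _; exact: of_.
Qed.

HB.instance Definition _ M := isOpenTopological.Build (tangent M)
  (@tangent_openT M) (@tangent_openI M) (@tangent_open_bigU M).

Lemma tangent_openE M : @open (tangent M) = @tangent_open M.
Proof. by []. Qed.

(* Meaningful only where g is differentiable. *)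
Definition velocity M (g : R -> M) (t : R) : tangent M :=
  (g t, 'D_1 (coord (chart_at (g t)) \o g) t).

(* To be used with J open. *)
Definition smooth_curve_on M (J : set R) (g : R -> M) : Prop :=
  (forall t, J t -> {for t, continuous g}) /\
  (forall c : chart M, smooth_on (J `&` g @^-1` dom c) (coord c \o g)).

(* A curve is smooth on a closed interval if it is so on a neighbourhood. *)
Definition smooth_curve M (a b : R) (g : R -> M) : Prop :=
  exists2 J : set R, open J /\ `[a, b] `<=` J & smooth_curve_on J g.

End TangentBundle.

Record riemannian (R : realType) (n : nat) := Riemannian {
  rmanifold :> manifold R n ;
  metric : rmanifold -> 'rV[R]_n -> 'rV[R]_n -> R ;
  metric_sym : forall x u v, metric x u v = metric x v u ;
  metric_linear : forall x k u v w,
    metric x (k *: u + v) w = k * metric x u w + metric x v w ;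
  metric_pos : forall x v, v != 0 -> 0 < metric x v v ;
  metric_smooth : forall (c : chart rmanifold) (v w : 'rV[R]_n),
    smooth_on (coord c @` dom c)
      (fun p => metric (cinv c p) (tinv c (p, v)).2 (tinv c (p, w)).2) }.

Section Distance.
Context {R : realType} {n : nat}.
Implicit Type M : riemannian R n.

Definition tnorm M (z : tangent M) : R := Num.sqrt (metric z.1 z.2 z.2).

Definition seg_length M (g : R -> M) : \bar R :=
  (\int[lebesgue_measure]_(t in `[0%R, 1%R]) (tnorm (velocity g t))%:E)%E.

(* [pw_path x y l]: some piecewise smooth path from x to y has length l. *)
Inductive pw_path M : M -> M -> \bar R -> Prop :=
| pw_path_nil x : pw_path x x 0%E
| pw_path_cons (g : R -> M) y l : smooth_curve 0 1 g -> pw_path (g 1) y l ->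
    pw_path (g 0) y (seg_length g + l)%E.

Definition geodist M (x y : M) : \bar R := ereal_inf [set l | pw_path x y l].

Definition geodesically_cauchy M (u : nat -> M) : Prop :=
  forall e : R, 0 < e -> exists k0 : nat, forall j k : nat,
    (k0 <= j)%N -> (k0 <= k)%N -> (geodist (u j) (u k) < e%:E)%E.

Definition complete_manifold M : Prop :=
  forall u : nat -> M, geodesically_cauchy u ->
    exists x : M, geodist (u k) x @[k --> \oo] --> 0%E.

Definition clamp (a b t : R) : R := Num.max a (Num.min b t).

Lemma clampK (a b t : R) : clamp a b (clamp a b t) = clamp a b t.
Proof. by rewrite /clamp /Num.max /Num.min; do !case: ifPn; lra. Qed.

Lemma clamp_continuous (a b : R) : continuous (clamp a b).
Proof.
move=> t; apply: continuous_max; first exact: cst_continuous.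
by apply: continuous_min; [exact: cst_continuous | exact: cvg_id].
Qed.

(* The space C([a,b];M): a continuous map on [a,b] is identified with its
   extension to R that is constant on each side of [a,b]. *)
Record curve M (a b : R) := Curve {
  curve_fun :> R -> M ;
  curve_continuous : continuous curve_fun ;
  curve_clamp : forall t, curve_fun t = curve_fun (clamp a b t) }.

Definition const_curve M (a b : R) (x : M) : curve M a b :=
  Curve (fun t => @cst_continuous R M x t) (fun _ => erefl).

HB.instance Definition _ M (a b : R) := gen_eqMixin (curve M a b).
HB.instance Definition _ M (a b : R) := gen_choiceMixin (curve M a b).
HB.instance Definition _ M (a b : R) :=
  isPointed.Build (curve M a b) (const_curve a b point).

Definition curve_dist M (a b : R) (g h : curve M a b) : \bar R :=
  ereal_sup [set geodist (g t) (h t) | t in `[a, b]].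

Definition curve_open M (a b : R) (U : set (curve M a b)) : Prop :=
  forall g, U g -> exists2 e : R, 0 < e &
    forall h, (curve_dist g h < e%:E)%E -> U h.

Lemma curve_openT M (a b : R) : @curve_open M a b setT.
Proof. by move=> g _; exists 1. Qed.

Lemma curve_openI M (a b : R) : setI_closed (@curve_open M a b).
Proof.
move=> A B oA oB g [/oA[e e0 eA] /oB[d d0 dB]].
exists (Num.min e d); first by rewrite lt_min e0.
move=> h gh; split; [apply: eA | apply: dB]; apply: (lt_le_trans gh).
- by rewrite lee_fin ge_min lexx.
- by rewrite lee_fin ge_min lexx orbT.
Qed.

Lemma curve_open_bigU M (a b : R) (I : Type) (f : I -> set (curve M a b)) :
  (forall i, curve_open (f i)) -> curve_open (\bigcup_i f i).
Proof.
move=> of_ g [i _ /of_[e e0 eU]]; exists e => // h gh.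
by exists i => //; exact: eU.
Qed.

HB.instance Definition _ M (a b : R) := isOpenTopological.Build (curve M a b)
  (@curve_openT M a b) (@curve_openI M a b) (@curve_open_bigU M a b).

Lemma curve_openE M (a b : R) : @open (curve M a b) = @curve_open M a b.
Proof. by []. Qed.

(* s lists nonoverlapping intervals [i.1, i.2] of [a,b], from left to right. *)
Definition abs_continuous M (a b : R) (g : R -> M) : Prop :=
  forall e : R, 0 < e -> exists2 d : R, 0 < d &
    forall s : seq (R * R),
      path <=%R a (rcons (flatten [seq [:: i.1; i.2] | i <- s]) b) ->
      \sum_(i <- s) (i.2 - i.1) < d ->
      (\sum_(i <- s) geodist (g i.1) (g i.2) < e%:E)%E.

End Distance.

Section Lagrangian.
Context {R : realType} {n : nat} {M : riemannian R n}.
Variable L : tangent M -> R.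

Definition lagrangian_smooth : Prop :=
  forall c : chart M, smooth_on (timg c) (L \o tinv c).

(* The Hessian is the one of L(x, .) on the vector space T_x M. *)
Definition lagrangian_convex : Prop :=
  forall K : set M, compact K -> exists2 c0 : R, 0 < c0 &
    forall (x : M) (v w : 'rV[R]_n), K x ->
      c0 * metric x w w <= 'D_w ('D_w (fun u => L (x, u))) v.

Definition lagrangian_growth : Prop :=
  exists c1 c2 : R, [/\ 0 < c1, 0 < c2 &
    forall z : tangent M, c1 * tnorm z - c2 <= L z].

Definition action (a b : R) (g : curve M a b) : \bar R :=
  if `[< abs_continuous a b g >]
  then (\int[lebesgue_measure]_(t in `[a, b]) (L (velocity g t))%:E)%E
  else +oo%E.

Definition mean_action (a b : R) (N : nat) (g : 'I_N -> curve M a b) : \bar R :=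
  ((N%:R^-1)%:E * \sum_(i < N) action (g i))%E.

(* The Euler-Lagrange equation at time t, in the coordinates (q, q') of every
   chart around g t, component by component:
   d/dt (dL/dv . w) (q, q') = (dL/dx . w) (q, q'). *)
Definition euler_lagrange_at (g : R -> M) (t : R) : Prop :=
  forall c : chart M, dom c (g t) -> forall w : 'rV[R]_n,
    let q s := (coord c (g s), 'D_1 (coord c \o g) s) in
    is_derive t (1 : R) (fun s => 'D_(0, w) (L \o tinv c) (q s))
      ('D_(w, 0) (L \o tinv c) (q t)).

Definition solves_euler_lagrange (a b : R) (g : R -> M) : Prop :=
  smooth_curve a b g /\ forall t, a <= t <= b -> euler_lagrange_at g t.

(* [g] is constant outside [a,b], so that the derivatives at a and b (one-sided
   derivatives on [a,b]) have to be those of a smooth extension. *)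
Definition extremal (a b : R) (g : curve M a b) : Prop :=
  exists2 h : R -> M, solves_euler_lagrange a b h &
    forall t, a <= t <= b -> g t = h t.

Definition stationary (a b : R) (N : nat) (g : 'I_N -> curve M a b) : Prop :=
  forall i, extremal (g i).

Definition extremals_between (a b : R) (K1 K2 : set M) : set (curve M a b) :=
  [set g | [/\ extremal g, K1 (g a) & K2 (g b)]].

(* Global existence of the flow is part of the definition. *)
Record euler_lagrange_flow (phi : R -> tangent M -> tangent M) : Prop := {
  flow0 : forall z, phi 0 z = z ;
  flowD : forall s t z, phi (s + t) z = phi s (phi t z) ;
  flow_continuous : continuous (fun q : R * tangent M => phi q.1 q.2) ;
  flow_smooth : forall c d : chart M,
    smooth_on
      [set q : R * ('rV[R]_n * 'rV[R]_n) |
        timg c q.2 /\ dom d (phi q.1 (tinv c q.2)).1]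
      (fun q => tcoord d (phi q.1 (tinv c q.2))) ;
  flow_solves : forall z a b,
    solves_euler_lagrange a b (fun t => (phi t z).1) ;
  flow_velocity : forall z t, velocity (fun s => (phi s z).1) t = phi t z ;
  flow_unique : forall a b (g : R -> M), solves_euler_lagrange a b g ->
    forall s t, a <= s <= b -> a <= t <= b ->
      velocity g t = phi (t - s) (velocity g s) }.

End Lagrangian.

Section FlowMap.
Context {R : realType} {n : nat} {M : riemannian R n}.

Lemma tangent_base_continuous : continuous (fun z : tangent M => z.1).
Proof.
apply/continuousP => U oU; rewrite tangent_openE => c.
rewrite (_ : _ `&` _ = timg c `&` (cinv c \o fst) @^-1` U) //.
rewrite openE => q [[cq _] Uq]; apply: filterI.
  by apply: open_nbhs_nbhs; split => //; exact: timg_open.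
have : {for q, continuous (cinv c \o fst)}.
  by apply: continuous_comp; [exact: cvg_fst | exact: cinv_continuous].
by apply; exact: open_nbhs_nbhs.
Qed.

Variables (L : tangent M -> R) (phi : R -> tangent M -> tangent M).
Hypothesis phiP : euler_lagrange_flow L phi.
Variables a b : R.

Definition flow_fun (z : tangent M) (t : R) : M :=
  (phi (clamp a b t - a) z).1.

Lemma flow_fun_continuous z : continuous (flow_fun z).
Proof.
move=> t; apply: (@continuous_comp _ _ _ (fun s => phi (clamp a b s - a) z)
  (fun y : tangent M => y.1)); last exact: tangent_base_continuous.
apply: (@continuous_comp _ _ _ (fun s => (clamp a b s - a, z))
  (fun q : R * tangent M => phi q.1 q.2)); last exact: (flow_continuous phiP).
have ct : clamp a b s - a @[s --> t] --> clamp a b t - a.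
  by apply: cvgB; [exact: clamp_continuous | exact: cvg_cst].
exact: (cvg_pair ct (cvg_cst z)).
Qed.

Lemma flow_fun_clamp z t : flow_fun z t = flow_fun z (clamp a b t).
Proof. by rewrite /flow_fun clampK. Qed.

Definition flow_map (z : tangent M) : curve M a b :=
  Curve (@flow_fun_continuous z) (@flow_fun_clamp z).

End FlowMap.

Notation borel T := (g_sigma_algebraType (@open T)).

Section Measures.
Local Open Scope ereal_scope.
Context {R : realType} {T : ptopologicalType}.

Section Empirical.
Variables (N : nat) (x : 'I_N -> borel T).

Definition empirical (A : set (borel T)) : \bar R :=
  (N%:R^-1)%:E * \sum_(i < N) \d_(x i) A.

Let empirical0 : empirical set0 = 0.
Proof. by rewrite /empirical big1 ?mule0// => i _; rewrite measure0. Qed.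

Let empirical_ge0 A : 0 <= empirical A.
Proof. by rewrite /empirical mule_ge0// ?lee_fin// sume_ge0. Qed.

Let empirical_sigma_additive : semi_sigma_additive empirical.
Proof.
pose y k := oapp x point (insub k : option 'I_N).
have N0 : (0 <= N%:R^-1 :> R)%R by [].
have -> : empirical =
    mscale (NngNum N0) (msum (fun k => dirac (y k)) N).
  apply/funext => A; rewrite /empirical /mscale/= /msum.
  by congr (_ * _); apply: eq_bigr => i _; rewrite /y valK.
exact: measure_semi_sigma_additive.
Qed.

HB.instance Definition _ := isMeasure.Build _ _ _ empirical
  empirical0 empirical_ge0 empirical_sigma_additive.

End Empirical.

Definition weak_cvg (mu : nat -> {measure set (borel T) -> \bar R})
    (nu : {measure set (borel T) -> \bar R}) : Prop :=
  forall f : T -> R, continuous f -> (exists B : R, forall x, (`|f x| <= B)%R) ->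
    \int[mu k]_x (f x)%:E @[k --> \oo] --> \int[nu]_x (f x)%:E.

End Measures.

(* Main.v *)
Require Import Defs.
From HB Require Import structures.
From mathcomp Require Import all_boot all_order all_algebra.
From mathcomp Require Import all_classical all_reals all_analysis.
From mathcomp Require Import measurable_realfun ring lra.
Import Defs.
Import Order.TTheory GRing.Theory Num.Theory numFieldNormedType.Exports.
Local Open Scope classical_set_scope.
Local Open Scope ring_scope.
Set Implicit Arguments.
Unset Strict Implicit.
Unset Printing Implicit Defensive.

(** An extremal is the orbit of its velocity [z] at time [a] under the
    Euler-Lagrange flow: it is [flow_map phiP a b z], and [flow_map] is continuous
    from the tangent bundle to the space of curves ([flow_map_continuous]). So it
    suffices to find a weak limit [eta] of the empirical measures of the initial
    velocities; [pi] is its image. The extremals between [Ka] and [Kb] correspond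
    to the initial velocities in the set [boundary_data], which is closed; hence
    the limit is still carried by them.

    Tightness. By the growth of [L], a bound on the mean action bounds the mean
    length of the curves ([action_flow_length], [sum_flow_length]), and by Markov's
    inequality most of them have length at most [m], for [m] large. Such a curve
    stays in the closed [m]-neighbourhood of [Ka], which is compact by the
    Hopf-Rinow theorem ([closed_nbhd_compact]); at some time [t] its speed is at
    most its average speed, which is at most [m / (b - a)]. Its initial velocity is
    thus the image under [phi (a - t)] of an element of a compact set of tangent
    vectors ([flow_length_cell]).

    Extraction. Countably many compact cells contain all initial velocities, and
    each is a continuous image of the Cantor set ([flow_cell_cantor]). Placing
    these Cantor sets one after the other on the half-line gives a closed set [D]
    of reals and a map [S], continuous on [D], such that every initial velocity is
    [S x] for some code [x] in [D] bounded in terms of the length of its curve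
    ([initial_velocity_coding]). The codes form a tight sequence of samples on the
    line, to which Helly's theorem applies ([helly_selection]): along a
    subsequence their quantile functions converge almost everywhere to some [Q].
    For [f] bounded and continuous on curves, [f \o flow_map phiP a b \o S] is
    continuous on [D], so the averages of [f] over the curves converge to the
    integral of [f (flow_map phiP a b (S (Q t)))] over [[0, 1]]; therefore [eta] is
    the law of [S \o Q] under the uniform probability on [[0, 1]].

    Hopf-Rinow is proved from the definition of the distance by lengths of
    piecewise smooth paths, without geodesics: the ingredients are the local
    comparison of the distance with coordinates ([chart_ball], [path_stays],
    [geodist_chart_le]) and the possibility of cutting a path at a prescribed
    length ([geodist_split]). *)

(** * Smooth maps in coordinates *)

Section LineDerivative.
Context {R : realType}.

Lemma is_derive_line (V W : normedModType R) (f : V -> W) (y v : V) (t : R) :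
  derivable f (y + t *: v) v ->
  is_derive t (1 : R) (fun s : R => f (y + s *: v)) ('D_v f (y + t *: v)).
Proof.
move=> fv.
have E : (fun h : R => h^-1 *: (((fun s : R => f (y + s *: v)) \o shift t) (h *: 1)
           - f (y + t *: v))) =
         (fun h : R => h^-1 *: ((f \o shift (y + t *: v)) (h *: v) - f (y + t *: v))).
  apply/funext => h /=; congr (_ *: (f _ - _)).
  by rewrite -[h%:A]/(h * 1) mulr1 scalerDl addrCA.
by split; [rewrite /derivable E | rewrite /derive E].
Qed.

Lemma mean_value_bound (f : R -> R) (s B : R) : 0 <= B ->
  (forall t : R, `|t| <= `|s| -> derivable f t (1 : R) /\ `|'D_1 f t| <= B) ->
  `|f s - f 0| <= B * `|s|.
Proof.
move=> B0 fs.
have der (t : R) : `|t| <= `|s| -> is_derive t (1 : R) f ('D_1 f t).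
  by move=> /fs[ft _]; exact: derivableP.
have con t : `|t| <= `|s| -> {for t, continuous f}.
  by move=> /fs[ft _]; apply: differentiable_continuous; apply/derivable1_diffP.
have [s0|s0] := leP 0 s.
- have [||c cs ->] := @MVT_segment R f ('D_1 f) 0 s s0.
  + by move=> t; rewrite in_itv/= => /andP[t0 ts]; apply: der; rewrite !ger0_norm// ltW.
  + apply: continuous_in_subspaceT => t; rewrite inE/= in_itv/= => /andP[t0 ts].
    by apply: con; rewrite !ger0_norm.
  rewrite subr0 normrM ler_wpM2r//; apply: (fs _ _).2.
  by move: cs; rewrite in_itv/= => /andP[? ?]; rewrite !ger0_norm.
- have [||c cs] := @MVT_segment R f ('D_1 f) s 0 (ltW s0).
  + move=> t; rewrite in_itv/= => /andP[t0 ts]; apply: der.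
    by rewrite !ler0_norm ?lerN2// ltW.
  + apply: continuous_in_subspaceT => t; rewrite inE/= in_itv/= => /andP[t0 ts].
    by apply: con; rewrite !ler0_norm ?lerN2// ltW.
  rewrite -normrN opprB => ->; rewrite sub0r normrM normrN ler_wpM2r//; apply: (fs _ _).2.
  by move: cs; rewrite in_itv/= => /andP[? ?]; rewrite !ler0_norm ?lerN2// ltW.
Qed.

End LineDerivative.

Section ContinuousPartials.
Context {R : realType} {n : nat}.
Implicit Types (x h : 'rV[R]_n).

Definition rV_prefix h (k : nat) : 'rV[R]_n := \row_j (if (j < k)%N then h 0 j else 0).

Lemma rV_prefix0 h : rV_prefix h 0 = 0.
Proof. by apply/rowP => j; rewrite !mxE. Qed.

Lemma rV_prefix_full h : rV_prefix h n = h.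
Proof. by apply/rowP => j; rewrite !mxE ltn_ord. Qed.

Lemma rV_prefixS h (k : 'I_n) :
  rV_prefix h k.+1 = rV_prefix h k + h 0 k *: delta_mx 0 k.
Proof.
apply/rowP => j; rewrite !mxE eqxx/= ltnS leq_eqVlt -val_eqE/=.
by case: eqVneq => [/val_inj ->|jk] /=; rewrite ?ltnn ?add0r ?mulr1// mulr0 addr0.
Qed.

Lemma coord_le_norm h (j : 'I_n) : `|h 0 j| <= `|h|.
Proof. by rewrite [leRHS]mx_normrE; exact: (le_bigmax _ (fun i => `|h i.1 i.2|) (0, j)). Qed.

Lemma norm_rV_le h (B : R) : 0 <= B -> (forall j, `|h 0 j| <= B) -> `|h| <= B.
Proof. by move=> B0 hB; rewrite [leLHS]mx_normrE; apply: bigmax_le => // -[i j] _; rewrite ord1. Qed.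

Lemma rV_prefix_step_le h (k : 'I_n) (t : R) : `|t| <= `|h 0 k| ->
  `|rV_prefix h k + t *: delta_mx 0 k| <= `|h|.
Proof.
move=> th; apply: norm_rV_le => // j; rewrite !mxE eqxx/=.
have [->|jk] := eqVneq j k.
  by rewrite ltnn add0r mulr1 (le_trans th)// coord_le_norm.
rewrite mulr0 addr0; case: ifP => _; last by rewrite normr0.
exact: coord_le_norm.
Qed.

(** The differential of a function with partial derivatives [c]. *)
Definition partial_sum_linear (c : 'I_n -> R) h : R := \sum_k h 0 k * c k.

Lemma partial_sum_is_linear c : linear (partial_sum_linear c).
Proof.
move=> a u v; rewrite /partial_sum_linear scaler_sumr -big_split/=.
by apply: eq_bigr => k _; rewrite !mxE mulrDl -mulrA.
Qed.

HB.instance Definition _ c :=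
  @GRing.isLinear.Build R 'rV[R]_n R *:%R (partial_sum_linear c) (partial_sum_is_linear c).

Lemma partial_sum_continuous c : continuous (partial_sum_linear c).
Proof.
apply: continuous_big => [|k _ x]; first exact: add_continuous.
exact: (cvgM (@matrix_normedtype.coord_continuous R 1 n 0 k x) (cvg_cst (c k))).
Qed.

(** The increment along [h] is a sum of increments along the coordinate axes,
    each controlled by the mean value theorem. *)
Lemma differentiable_partials (f : 'rV[R]_n -> R) x :
  (\forall y \near x, forall k, derivable f y (delta_mx 0 k)) ->
  (forall k, {for x, continuous ('D_(delta_mx 0 k) f)}) ->
  differentiable f x.
Proof.
move=> df cf.
pose c k := 'D_(delta_mx 0 k) f x.
suff E : f \o shift x = cst (f x) + partial_sum_linear c +o_ (0 : 'rV[R]_n) id.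
  apply/diff_locallyP; rewrite (diff_unique (@partial_sum_continuous c) E).
  by split => //; exact: partial_sum_continuous.
apply/eqaddoP => e e0.
pose d := e / n.+1%:R.
have d0 : 0 < d by rewrite divr_gt0.
have H k : \forall y \near x, derivable f y (delta_mx 0 k) /\
    `|'D_(delta_mx 0 k) f y - c k| <= d.
  apply: filterS2 df _; first by move=> y fy cy; split; [exact: fy | exact: cy].
  by have /cvgrPdistC_le/(_ d d0) := cf k.
have {}H := filter_forall (nbhs_filter x) H.
have /nbhs_ballP[r /= r0 rx] := H.
apply/nbhs_ballP; exists r => //= h; rewrite -ball_normE/= sub0r normrN => hr.
suff -> : (f \o shift x - (cst (f x) + partial_sum_linear c)) h =
    \sum_(k < n) (f (x + rV_prefix h k.+1) - f (x + rV_prefix h k) - h 0 k * c k).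
  apply: le_trans (ler_norm_sum _ _ _) _.
  apply: (@le_trans _ _ (\sum_(k < n) d * `|h|)); last first.
    rewrite sumr_const card_ord -[_ *+ n]mulr_natr mulrAC ler_wpM2r// /d.
    by rewrite mulrAC ler_pdivrMr// ler_wpM2l ?ler_nat// ltW.
  apply: ler_sum => k _.
  pose g t := f (x + rV_prefix h k + t *: delta_mx 0 k) - t * c k.
  have -> : f (x + rV_prefix h k.+1) - f (x + rV_prefix h k) - h 0 k * c k = g (h 0 k) - g 0.
    by rewrite /g scale0r mul0r addr0 subr0 rV_prefixS [in LHS]addrA [LHS]addrAC.
  apply: (@le_trans _ _ (d * `|h 0 k|)); last by rewrite ler_wpM2l ?coord_le_norm// ltW.
  apply: mean_value_bound; first exact: ltW.
  move=> t th.
  have [|dft Dft] := rx (x + rV_prefix h k + t *: delta_mx 0 k) _ k.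
    rewrite -ball_normE/= -!addrA opprD addNKr normrN.
    by apply: le_lt_trans hr; exact: rV_prefix_step_le.
  have D1 := is_derive_line dft.
  have D2 : is_derive t (1:R) (fun t : R => t * c k) (c k).
    rewrite (_ : *%R^~ _ = c k *: (id : R -> R)); last by apply/funext => s; rewrite mulrC.
    by rewrite -[X in is_derive _ _ _ X]mulr1; exact: is_deriveZ.
  have D : is_derive t (1:R) g ('D_(delta_mx 0 k) f (x + rV_prefix h k + t *: delta_mx 0 k) - c k).
    exact: is_deriveB.
  by rewrite derive_val.
rewrite sumrB -(big_mkord xpredT (fun k => f (x + rV_prefix h k.+1) - f (x + rV_prefix h k))).
by rewrite (telescope_sumr (fun k => f (x + rV_prefix h k)))// rV_prefix0 rV_prefix_full addr0
    -[LHS]/(f (h + x) - (f x + partial_sum_linear c h)) opprD addrA (addrC h).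
Qed.

End ContinuousPartials.

Section SmoothMaps.
Context {R : realType}.

Lemma near_eq_continuous (T U : topologicalType) (f g : T -> U) (x : T) :
  (\near x, f x = g x) -> {for x, continuous f} -> {for x, continuous g}.
Proof.
move=> fg cf; have {}cf : f y @[y --> x] --> f x := cf.
rewrite (nbhs_singleton fg) in cf; apply: cvg_trans cf; apply: near_eq_cvg.
by apply: filterS fg.
Qed.

Lemma deriveZv (V W : normedModType R) (f : V -> W) x (a : R) u :
  differentiable f x -> 'D_(a *: u) f x = a *: 'D_u f x.
Proof. by move=> df; rewrite !deriveE// linearZ. Qed.

Lemma smooth_on_continuous (V W : normedModType R) (U : set V) (f : V -> W) x :
  smooth_on U f -> U x -> {for x, continuous f}.
Proof. by move=> fU Ux; have [] := fU [::] x Ux. Qed.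

Lemma smooth_on_derivable (V W : normedModType R) (U : set V) (f : V -> W) x v :
  smooth_on U f -> U x -> derivable f x v.
Proof. by move=> fU Ux; have [] := fU [::] x Ux. Qed.

Lemma smooth_on_derive (V W : normedModType R) (U : set V) (f : V -> W) v :
  smooth_on U f -> smooth_on U ('D_v f).
Proof.
move=> fU s x Ux; have := fU (rcons s v) x Ux.
by rewrite foldr_rcons.
Qed.

Lemma smooth_on_sub (V W : normedModType R) (U U' : set V) (f : V -> W) :
  U' `<=` U -> smooth_on U f -> smooth_on U' f.
Proof. by move=> UU' fU s x /UU'; exact: fU. Qed.

Lemma differentiable_rV (V : normedModType R) m (f : V -> 'rV[R]_m) x :
  (forall j, differentiable (fun y => f y 0 j) x) -> differentiable f x.
Proof.
move=> df.
rewrite (_ : f = \sum_(j < m) (fun y => f y 0 j *: (delta_mx 0 j : 'rV[R]_m))); last first.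
  apply/funext => y; rewrite fct_sumE [LHS]row_sum_delta.
  by apply: eq_bigr => j _.
apply: differentiable_sum => j.
exact: differentiableZl.
Qed.

Lemma smooth_on_coord (V : normedModType R) m (U : set V) (f : V -> 'rV[R]_m) (j : 'I_m) :
  open U -> smooth_on U f -> smooth_on U (fun y => f y 0 j).
Proof.
move=> oU fU s.
suff E : forall x, U x -> foldr (fun v k => 'D_v k) (fun y => f y 0 j) s x =
    foldr (fun v (k : V -> 'rV[R]_m) => 'D_v k) f s x 0 j.
  move=> x Ux.
  have [cf df] := fU s x Ux.
  have near_eq : \near x, foldr (fun v (k : V -> 'rV[R]_m) => 'D_v k) f s x 0 j =
      foldr (fun v k => 'D_v k) (fun y => f y 0 j) s x.
    have := open_nbhs_nbhs (conj oU Ux).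
    by apply: filterS => y Uy; rewrite E.
  split.
    have h : {for x, continuous (fun y => foldr (fun v (k : V -> 'rV[R]_m) => 'D_v k) f s y 0 j)}.
      apply: (@continuous_comp _ _ _ _ (fun M : 'rV[R]_m => M 0 j)) => //.
      exact: matrix_normedtype.coord_continuous.
    exact: near_eq_continuous near_eq h.
  move=> v; apply: (near_eq_derivable near_eq).
  by move/derivable_mxP : (df v); exact.
elim: s => [//|v s IH] x Ux /=.
have [_ df] := fU s x Ux.
rewrite (derive_mx (df v)) mxE.
apply: near_eq_derive.
have := open_nbhs_nbhs (conj oU Ux).
by apply: filterS => y Uy; rewrite IH.
Qed.

(** Smoothness is defined through directional derivatives; differentiability,
    hence the chain rule, comes from the continuity of the partial ones. *)
Lemma smooth_on_differentiable n m (U : set 'rV[R]_n) (f : 'rV[R]_n -> 'rV[R]_m) x :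
  open U -> smooth_on U f -> U x -> differentiable f x.
Proof.
move=> oU fU Ux; apply: differentiable_rV => j.
have fj := smooth_on_coord j oU fU.
apply: differentiable_partials => [|k].
  have := open_nbhs_nbhs (conj oU Ux).
  by apply: filterS => y Uy k; exact: smooth_on_derivable fj Uy.
exact: smooth_on_continuous (smooth_on_derive _ fj) Ux.
Qed.

Lemma smooth_on_differentiable1 m (U : set R) (f : R -> 'rV[R]_m) x :
  smooth_on U f -> U x -> differentiable f x.
Proof. by move=> fU Ux; apply/derivable1_diffP; exact: smooth_on_derivable fU Ux. Qed.

Lemma derive_linear (V W : normedModType R) (f : V -> W) x (a : R) u v :
  differentiable f x -> 'D_(a *: u + v) f x = a *: 'D_u f x + 'D_v f x.
Proof. by move=> df; rewrite !deriveE// linearP. Qed.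

Lemma derive_comp (U V W : normedModType R) (f : U -> V) (g : V -> W) x v :
  differentiable f x -> differentiable g (f x) ->
  'D_v (g \o f) x = 'D_('D_v f x) g (f x).
Proof.
move=> df dg; rewrite deriveE; last exact: differentiable_comp.
by rewrite diff_comp//= !deriveE.
Qed.

(** The iterated derivatives of the restriction are constant multiples of those
    of [f] along [w]. *)
Lemma smooth_on_line (V W : normedModType R) (U : set V) (f : V -> W) (p w : V) :
  open U -> smooth_on U f ->
  smooth_on [set t : R | U (p + t *: w)] (fun t => f (p + t *: w)).
Proof.
move=> oU fU.
have ol : open [set t : R | U (p + t *: w)].
  apply: (@open_comp _ _ (fun t : R => p + t *: w)) => // t _.
  by apply: cvgD; [exact: cvg_cst | apply: cvgZr_tmp; exact: cvg_id].
have lin c (g : V -> W) t : derivable g (p + t *: w) w ->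
    is_derive t (c : R) (fun t : R => g (p + t *: w)) (c *: 'D_w g (p + t *: w)).
  move=> dg; have d1 := is_derive_line dg.
  have df1 : differentiable (fun t : R => g (p + t *: w)) t by apply/derivable1_diffP.
  have dfc : derivable (fun t : R => g (p + t *: w)) t c by exact: diff_derivable.
  have -> : c *: 'D_w g (p + t *: w) = 'D_c (fun t : R => g (p + t *: w)) t.
    rewrite -[X in 'D_X _ t]mulr1 -[X in 'D_X _ t]/(c *: (1 : R)) deriveZv//.
    by rewrite [in RHS]derive_val.
  exact: derivableP.
move=> s.
pose h k := foldr (fun (v : V) (k : V -> W) => 'D_v k) f (nseq k w).
have hs k t : U (p + t *: w) -> derivable (h k) (p + t *: w) w.
  by move=> Ut; have [_] := fU (nseq k w) _ Ut; exact.
have [c E] : exists c : R, forall t, U (p + t *: w) ->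
    foldr (fun v k => 'D_v k) (fun t : R => f (p + t *: w)) s t = c *: h (size s) (p + t *: w).
  elim: s => [|v s [c IH]] /=; first by exists 1 => t _; rewrite scale1r.
  exists (c * v) => t Ut.
  have -> : 'D_v (foldr (fun v k => 'D_v k) (fun t : R => f (p + t *: w)) s) t =
     'D_v (c *: (fun t : R => h (size s) (p + t *: w))) t.
    apply: near_eq_derive; have := open_nbhs_nbhs (conj ol Ut).
    by apply: filterS => y Uy; rewrite IH.
  have dl := lin v _ _ (hs (size s) t Ut).
  by rewrite deriveZ//; rewrite derive_val scalerA.
move=> t Ut.
have near_eq : \near t, c *: h (size s) (p + t *: w) =
    foldr (fun v k => 'D_v k) (fun t : R => f (p + t *: w)) s t.
  have := open_nbhs_nbhs (conj ol Ut).
  by apply: filterS => y Uy; rewrite E.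
have dl v := lin v _ _ (hs (size s) t Ut).
split.
  apply: near_eq_continuous near_eq _.
  have d1 : derivable (c *: (fun t => h (size s) (p + t *: w))) t 1.
    by apply: derivableZ; have := dl 1 => ?; exact: ex_derive.
  by apply: differentiable_continuous; apply/derivable1_diffP.
move=> v; apply: (near_eq_derivable near_eq).
have dv : derivable (c *: (fun t => h (size s) (p + t *: w))) t v.
  by apply: derivableZ; have := dl v => ?; exact: ex_derive.
exact: dv.
Qed.

End SmoothMaps.

(** * Charts, tangent vectors and their norms *)

Lemma closed_preimage (T U : topologicalType) (f : T -> U) (D : set U) :
  continuous f -> closed D -> closed (f @^-1` D).
Proof. by move=> cf; apply: preimage_closed => x _; exact: cf. Qed.

Section Charts.
Context {R : realType} {n : nat} {M : manifold R n}.
Implicit Types (c d e : chart M) (x : M).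

Lemma chart_imgK c p : (coord c @` dom c) p -> coord c (cinv c p) = p.
Proof. by case=> x cx <-; rewrite coordK. Qed.

Lemma chart_img_dom c p : (coord c @` dom c) p -> dom c (cinv c p).
Proof. by case=> x cx <-; rewrite coordK. Qed.

Lemma chart_imgP c x : dom c x -> (coord c @` dom c) (coord c x).
Proof. by move=> cx; exists x. Qed.

Lemma overlapE c (U : set M) :
  coord c @` (dom c `&` U) = (coord c @` dom c) `&` cinv c @^-1` U.
Proof.
apply/seteqP; split => [p [x [cx Ux] <-]|p [[x cx <-]]] /=.
  by split; [exact: chart_imgP | rewrite coordK].
by rewrite coordK// => Ux; exists x.
Qed.

Lemma overlap_open c (U : set M) : open U -> open (coord c @` (dom c `&` U)).
Proof.
move=> oU; rewrite overlapE openE => p [cp Up]; apply: filterI.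
  by apply: open_nbhs_nbhs; split => //; exact: img_open.
by apply: (cinv_continuous cp); exact: open_nbhs_nbhs.
Qed.

Lemma near_overlap c (U : set M) x : open U -> dom c x -> U x ->
  \forall p \near coord c x, (coord c @` dom c) p /\ U (cinv c p).
Proof.
move=> oU cx Ux; have := @overlap_open c U oU.
rewrite overlapE => oO; apply: (open_nbhs_nbhs (conj oO _)).
by split; [exact: chart_imgP | rewrite /= coordK].
Qed.

Lemma transition_differentiable c d x : dom c x -> dom d x ->
  differentiable (coord d \o cinv c) (coord c x).
Proof.
move=> cx dx; have oO := @overlap_open c _ (dom_open d).
by apply: (smooth_on_differentiable oO (@transition_smooth _ _ M c d)); exists x.
Qed.

Lemma transition_id c x v : dom c x -> 'D_v (coord c \o cinv c) (coord c x) = v.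
Proof.
move=> cx; rewrite -[RHS](derive_id (coord c x) v).
apply: near_eq_derive; have := near_overlap (@openT M) cx I.
by apply: filterS => p [cp _] /=; rewrite chart_imgK.
Qed.

(** The chain rule for changes of charts. It makes the stored coordinates of a
    tangent vector independent of the chart used to reach them. *)
Lemma transition_cocycle c d e x v : dom c x -> dom d x -> dom e x ->
  'D_('D_v (coord d \o cinv c) (coord c x)) (coord e \o cinv d) (coord d x) =
  'D_v (coord e \o cinv c) (coord c x).
Proof.
move=> cx dx ex.
have -> : 'D_v (coord e \o cinv c) (coord c x) =
    'D_v ((coord e \o cinv d) \o (coord d \o cinv c)) (coord c x).
  apply: near_eq_derive; have := near_overlap (dom_open d) cx dx.
  by apply: filterS => p [cp dp] /=; rewrite coordK.
rewrite derive_comp/= ?coordK//; first exact: transition_differentiable.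
exact: transition_differentiable.
Qed.

Lemma curve_chart_change c d (g : R -> M) (t : R) :
  {for t, continuous g} -> dom c (g t) -> dom d (g t) ->
  differentiable (coord c \o g) t ->
  'D_1 (coord d \o g) t =
  'D_('D_1 (coord c \o g) t) (coord d \o cinv c) (coord c (g t)).
Proof.
move=> gt ct dt cg; rewrite -[RHS](derive_comp (f := coord c \o g))//; last first.
  exact: transition_differentiable.
apply: near_eq_derive.
have : \forall s \near t, dom c (g s) by apply: gt; apply: open_nbhs_nbhs; split; [exact: dom_open|].
by apply: filterS => s cs /=; rewrite coordK.
Qed.

Lemma velocity_chart c (g : R -> M) (t : R) :
  {for t, continuous g} -> dom c (g t) -> differentiable (coord c \o g) t ->
  velocity g t = tinv c (coord c (g t), 'D_1 (coord c \o g) t).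
Proof.
move=> gt ct cg; rewrite /velocity /tinv/= coordK//; congr (_, _).
by apply: curve_chart_change => //; exact: dom_chart_at.
Qed.

Lemma tcoordK c (z : tangent M) : dom c z.1 -> tinv c (tcoord c z) = z.
Proof.
case: z => x v /= cx; rewrite /tinv /tcoord/= coordK//; congr (_, _).
rewrite transition_cocycle ?transition_id//; exact: dom_chart_at.
Qed.

Lemma tinv_continuous c q : timg c q -> {for q, continuous (tinv c)}.
Proof.
move=> cq U; rewrite nbhsE => -[V [oV Vq] VU].
have := oV; rewrite tangent_openE => /(_ c) oc.
have : nbhs q (timg c `&` tinv c @^-1` V) by apply: open_nbhs_nbhs.
by apply: filterS => p [_ /VU].
Qed.

(** The topology of the tangent bundle is the final one for the charts. *)
Lemma continuous_tangent (T : topologicalType) (f : tangent M -> T) :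
  (forall c q, timg c q -> {for q, continuous (f \o tinv c)}) -> continuous f.
Proof.
move=> cf; apply/continuousP => U oU; rewrite tangent_openE => c.
rewrite openE => q [cq Uq]; apply: filterI.
  by apply: open_nbhs_nbhs; split => //; exact: timg_open.
by apply: (cf c q cq); exact: open_nbhs_nbhs.
Qed.

Lemma tinv_linear c p (a : R) u v : (coord c @` dom c) p ->
  (tinv c (p, a *: u + v)).2 = a *: (tinv c (p, u)).2 + (tinv c (p, v)).2.
Proof.
case=> x cx <-; rewrite /tinv/= coordK// derive_linear//.
by apply: transition_differentiable => //; exact: dom_chart_at.
Qed.

Lemma tinv_eq0 c p v : (coord c @` dom c) p -> (tinv c (p, v)).2 = 0 -> v = 0.
Proof.
case=> x cx <-; rewrite /tinv/= coordK// => E.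
rewrite -(transition_id v cx) -(transition_cocycle v cx (dom_chart_at x) cx) E.
exact: derive0.
Qed.

End Charts.

Section LocalNorm.
Context {R : realType} {n : nat} {M : riemannian R n}.
Implicit Types (c : chart M) (x : M).

Lemma metric0 x w : metric x 0 w = 0.
Proof. by have := metric_linear x (-1) 0 0 w; rewrite scaler0 addr0 mulN1r addNr. Qed.

Lemma metricZ x k u w : metric x (k *: u) w = k * metric x u w.
Proof. by have := metric_linear x k u 0 w; rewrite metric0 !addr0. Qed.

Lemma metric_suml x (I : finType) (a : I -> R) (u : I -> 'rV[R]_n) w :
  metric x (\sum_i a i *: u i) w = \sum_i a i * metric x (u i) w.
Proof.
elim/big_rec2: _ => [|i y1 y2 _ IH]; first exact: metric0.
by rewrite metric_linear IH.
Qed.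

Lemma tnorm_ge0 (z : tangent M) : 0 <= tnorm z.
Proof. exact: sqrtr_ge0. Qed.

Lemma tnormZ x (k : R) v : tnorm ((x, k *: v) : tangent M) = `|k| * tnorm ((x, v) : tangent M).
Proof.
rewrite /tnorm/= metricZ metric_sym metricZ mulrA -expr2.
by rewrite sqrtrM ?sqr_ge0// sqrtr_sqr.
Qed.

Lemma tnorm_gt0 x v : v != 0 -> 0 < tnorm ((x, v) : tangent M).
Proof. by move=> v0; rewrite sqrtr_gt0; exact: metric_pos. Qed.

(** The Gram matrix of the coordinate frame. *)
Let G c (i j : 'I_n) p :=
  metric (cinv c p) (tinv c (p, delta_mx 0 i)).2 (tinv c (p, delta_mx 0 j)).2.

Lemma tinv_sum c p w : (coord c @` dom c) p ->
  (tinv c (p, w)).2 = \sum_i w 0 i *: (tinv c (p, delta_mx 0 i)).2.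
Proof.
move=> cp; rewrite {1}[w]row_sum_delta.
elim/big_rec2: _ => [|i y1 y2 _ IH]; first by rewrite /tinv/= derive0.
by rewrite tinv_linear// IH.
Qed.

Lemma tnorm_tinv c p w : (coord c @` dom c) p ->
  tnorm (tinv c (p, w)) =
  Num.sqrt (\sum_i w 0 i * \sum_j w 0 j * G c i j p).
Proof.
move=> cp; rewrite /tnorm tinv_sum// metric_suml; congr Num.sqrt.
apply: eq_bigr => i _; congr (_ * _); rewrite metric_sym metric_suml.
by apply: eq_bigr => j _; rewrite metric_sym.
Qed.

Lemma tnorm_tinv_continuous c q : timg c q ->
  {for q, continuous (@tnorm R n M \o tinv c)}.
Proof.
move=> cq.
apply: (@near_eq_continuous _ _ (fun q : 'rV[R]_n * 'rV[R]_n =>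
  Num.sqrt (\sum_i q.2 0 i * \sum_j q.2 0 j * G c i j q.1))).
  have := open_nbhs_nbhs (conj (@timg_open R n M c) cq).
  by apply: filterS => -[p w] [cp _]; rewrite /= tnorm_tinv.
apply: (@continuous_comp _ _ _ (fun q : 'rV[R]_n * 'rV[R]_n =>
   \sum_i q.2 0 i * \sum_j q.2 0 j * G c i j q.1) Num.sqrt); last exact: sqrt_continuous.
have co i : {for q, continuous (fun q : 'rV[R]_n * 'rV[R]_n => q.2 0 i)}.
  apply: (@continuous_comp _ _ _ snd (fun M : 'rV[R]_n => M 0 i)); first exact: cvg_snd.
  exact: matrix_normedtype.coord_continuous.
have cG i j : {for q, continuous (fun q : 'rV[R]_n * 'rV[R]_n => G c i j q.1)}.
  apply: (@continuous_comp _ _ _ fst (G c i j)); first exact: cvg_fst.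
  have sm := @metric_smooth R n M c (delta_mx 0 i) (delta_mx 0 j).
  exact: (smooth_on_continuous sm cq.1).
apply: cvg_big => [|i _]; first exact: add_continuous.
apply: cvgM; first exact: co.
apply: cvg_big => [|j _]; first exact: add_continuous.
by apply: cvgM; [exact: co | exact: cG].
Qed.

Lemma tnorm_continuous : continuous (@tnorm R n M).
Proof. by apply: continuous_tangent => c q; exact: tnorm_tinv_continuous. Qed.

Lemma tnorm_tinvZ c p (k : R) w : (coord c @` dom c) p ->
  tnorm (tinv c (p, k *: w)) = `|k| * tnorm (tinv c (p, w)).
Proof.
move=> cp; rewrite -tnormZ; congr tnorm.
rewrite /tinv/=; congr (_, _).
by have := tinv_linear k w 0 cp; rewrite addr0 /tinv/= derive0 addr0.
Qed.

Lemma tnorm_tinv_gt0 c p w : (coord c @` dom c) p -> w != 0 ->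
  0 < tnorm (tinv c (p, w)).
Proof. by move=> cp w0; apply: tnorm_gt0; apply: contra_neq w0; exact: tinv_eq0. Qed.

Lemma rV_ball_compact (p : 'rV[R]_n) (r : R) : compact [set q | `|q - p| <= r].
Proof.
apply: bounded_closed_compact.
  exists (`|p| + r); split; first exact: num_real.
  move=> s sr q /= qp; rewrite (le_trans _ (ltW sr))//.
  by rewrite -[q in `|q|](subrK p) addrC (le_trans (ler_normD _ _))// lerD2l.
apply: (@closed_preimage 'rV[R]_n R (fun q : 'rV[R]_n => `|q - p|) [set t | t <= r]); last exact: closed_le.
move=> q; apply: (@continuous_comp _ _ _ (fun q : 'rV[R]_n => q - p)); last exact: norm_continuous.
exact: (@cvgB R 'rV[R]_n _ (nbhs q) _ id (cst p) q p cvg_id (cvg_cst p)).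
Qed.

Lemma rV_sphere_compact : compact [set w : 'rV[R]_n | `|w| = 1].
Proof.
rewrite (_ : mkset _ = [set q | `|q - 0| <= 1] `&` [set w | `|w| = 1]); last first.
  by apply/seteqP; split => [w /= w1|w []//]; rewrite subr0 w1.
apply: compact_closedI; first exact: rV_ball_compact.
apply: (@closed_preimage _ _ (fun w : 'rV[R]_n => `|w|) [set 1]); last exact: closed_eq.
by move=> w; exact: norm_continuous.
Qed.

(** Both norms are homogeneous in [w], and their quotient is continuous and
    positive on the product of the compact ball and the unit sphere. *)
Lemma tnorm_equiv c (p0 : 'rV[R]_n) (r : R) :
  [set p | `|p - p0| <= r] `<=` coord c @` dom c ->
  exists l B : R, [/\ 0 < l, 0 < B & forall p w : 'rV[R]_n, `|p - p0| <= r ->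
    l * `|w| <= tnorm (tinv c (p, w)) <= B * `|w|].
Proof.
move=> rc; pose A := [set p | `|p - p0| <= r] `*` [set w : 'rV[R]_n | `|w| = 1].
pose f := @tnorm R n M \o tinv c.
have cA : compact A by apply: compact_setX; [exact: rV_ball_compact | exact: rV_sphere_compact].
have fA : {within A, continuous f}.
  apply: continuous_in_subspaceT => q; rewrite inE => -[/= q1 _].
  by apply: tnorm_tinv_continuous; split => //; exact: rc.
have [A0|A0] := pselect (A !=set0); last first.
  exists 1, 1; split => // p w pr.
  have -> : w = 0.
    apply: contra_notP A0 => /eqP w0; exists (p, `|w|^-1 *: w); split => //=.
    by rewrite normrZ normfV normr_id mulVf// normr_eq0.
  have cp := rc p pr.
  by rewrite -[X in tinv c (_, X)](scale0r (0 : 'rV[R]_n)) tnorm_tinvZ// !normr0 mul0r mulr0 lexx.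
have [q1 + q1P] := compact_EVT_min A0 cA fA; rewrite inE => -[q11 q12].
have [q2 + q2P] := compact_EVT_max A0 cA fA; rewrite inE => -[q21 q22].
have pos q : A q -> 0 < f q.
  move: q => [p w] [/= pr w1]; apply: tnorm_tinv_gt0; first exact: rc.
  by rewrite -normr_eq0 w1 oner_eq0.
exists (f q1), (f q2); split; [exact: pos|exact: pos|] => p w pr.
have cp := rc p pr.
have [->|w0] := eqVneq w 0.
  by rewrite -[X in tinv c (_, X)](scale0r (0 : 'rV[R]_n)) tnorm_tinvZ// !normr0 mul0r !mulr0 lexx.
have w0' : 0 < `|w| by rewrite normr_gt0.
have Aq : A (p, `|w|^-1 *: w).
  by split => //=; rewrite normrZ normfV normr_id mulVf// normr_eq0.
have -> : tnorm (tinv c (p, w)) = `|w| * f (p, `|w|^-1 *: w).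
  rewrite -[LHS](mulVKf (lt0r_neq0 w0')); congr (_ * _).
  have E := tnorm_tinvZ `|w|^-1 w cp.
  by rewrite normfV normr_id in E; rewrite -E.
by rewrite ![`|w| * _]mulrC !ler_pM2r// q1P ?q2P// inE.
Qed.

(** Coordinate balls on which lengths on the manifold and lengths in coordinates
    control each other: all local estimates of the distance rest on them. *)
Lemma chart_ball x (U : set M) : nbhs x U ->
  exists c (r l B : R), [/\ dom c x, [/\ 0 < r, 0 < l & 0 < B],
    (forall p : 'rV[R]_n, `|p - coord c x| <= r -> (coord c @` dom c) p /\ U (cinv c p)) &
    forall p w : 'rV[R]_n, `|p - coord c x| <= r ->
      l * `|w| <= tnorm (tinv c (p, w)) <= B * `|w|].
Proof.
rewrite nbhsE => -[V [oV Vx] VU]; pose c := chart_at x.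
have cx : dom c x := dom_chart_at x.
have /nbhs_ballP[e /= e0 eV] := near_overlap oV cx Vx.
have e20 : 0 < e / 2 by rewrite divr_gt0.
have eP p : `|p - coord c x| <= e / 2 -> (coord c @` dom c) p /\ V (cinv c p).
  move=> pr; apply: eV; rewrite -ball_normE/= distrC (le_lt_trans pr)//.
  by rewrite gtr_pMr// invf_lt1// ltr1n.
have [|l [B [l0 B0 lB]]] := @tnorm_equiv c (coord c x) (e / 2).
  by move=> p /eP[].
exists c, (e / 2), l, B; split => // p /eP[cp Vp]; split => //; exact: VU.
Qed.

End LocalNorm.

(** * Lengths and the geodesic distance *)

Section Primitives.
Context {R : realType}.
Local Notation mu := lebesgue_measure.

Lemma within_continuous (a b : R) (f : R -> R) : continuous f -> {within `[a, b], continuous f}.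
Proof. by move=> cf; apply: continuous_subspaceT. Qed.

Lemma integral_primitive (s F : R -> R) (a b : R) : a <= b -> continuous s ->
  (forall t, a <= t <= b -> is_derive t (1 : R) F (s t)) ->
  (\int[mu]_(x in `[a, b]) (s x)%:E = (F b - F a)%:E)%E.
Proof.
rewrite le_eqVlt => /predU1P[<- _ _|ab cs dF].
  by rewrite set_itv1 integral_set1 subrr.
have cF t : a <= t <= b -> F x @[x --> t] --> F t.
  move=> /dF Ft; apply: differentiable_continuous; apply/derivable1_diffP.
  exact: ex_derive.
rewrite (@continuous_FTC2 _ s F a b ab) ?EFinB//.
- exact: within_continuous.
- split.
  + move=> t; rewrite in_itv/= => /andP[ta tb].
    by have Ft := dF t; apply: ex_derive; apply: Ft; rewrite !ltW.
  + by apply: cvg_at_right_filter; apply: cF; rewrite lexx ltW.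
  + by apply: cvg_at_left_filter; apply: cF; rewrite lexx ltW.
- move=> t; rewrite in_itv/= => /andP[ta tb].
  have Ft : is_derive t (1 : R) F (s t) by apply: dF; rewrite !ltW.
  by rewrite derive1E derive_val.
Qed.

Lemma primitive_exists (s : R -> R) (A : R) : continuous s ->
  exists F : R -> R, forall t, A < t -> is_derive t (1 : R) F (s t).
Proof.
move=> cs; exists (fun x => \int[mu]_(t in `[A, x]) (s t))%R => t At.
have [||] := @continuous_FTC1_closed _ s A t (t + 1) _ _ At (cs t).
- by rewrite ltrDl.
- by apply: continuous_compact_integrable; [exact: segment_compact | exact: within_continuous].
move=> dF; rewrite derive1E => <-; exact: derivableP.
Qed.

End Primitives.

Lemma is_derive_affine {R : realType} (p w t : R) : is_derive t (1 : R) (fun s => p + s * w) w.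
Proof.
have -> : (fun s => p + s * w) = cst p + w *: (id : R -> R).
  by apply/funext => s /=; rewrite mulrC.
by rewrite -[X in is_derive _ _ _ X]add0r -[w in 0 + w]mulr1; apply: is_deriveD; apply: is_deriveZ.
Qed.

Lemma affine_continuous {R : realType} (p w : R) : continuous (fun s : R => p + s * w).
Proof. move=> t; exact: (cvgD (cvg_cst p) (cvgM cvg_id (cvg_cst w))). Qed.

Section SmoothCurves.
Context {R : realType} {n : nat} {M : manifold R n}.
Implicit Types (g : R -> M) (J : set R).

Lemma curve_dom_open J g (U : set M) : open J -> (forall t, J t -> {for t, continuous g}) ->
  open U -> open (J `&` g @^-1` U).
Proof.
move=> oJ cg oU; rewrite openE => t [Jt Ut]; apply: filterI.
  exact: open_nbhs_nbhs.
by apply: (cg t Jt); exact: open_nbhs_nbhs.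
Qed.

Lemma smooth_curve_differentiable J g c t : smooth_curve_on J g -> J t -> dom c (g t) ->
  differentiable (coord c \o g) t.
Proof. by move=> [cg sg] Jt ct; apply: (smooth_on_differentiable1 (sg c)). Qed.

Lemma smooth_curve_velocity J g c t : smooth_curve_on J g -> J t -> dom c (g t) ->
  velocity g t = tinv c (coord c (g t), 'D_1 (coord c \o g) t).
Proof.
move=> sg Jt ct; apply: velocity_chart => //; first exact: sg.1.
exact: smooth_curve_differentiable sg Jt ct.
Qed.

Lemma velocity_continuous J g t : open J -> smooth_curve_on J g -> J t ->
  {for t, continuous (velocity g : R -> tangent M)}.
Proof.
move=> oJ sg Jt; pose c := chart_at (g t); have ct : dom c (g t) := dom_chart_at (g t).
have oO := curve_dom_open oJ sg.1 (dom_open c).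
apply: (@near_eq_continuous _ _ (fun s => tinv c (coord c (g s), 'D_1 (coord c \o g) s))).
  have := open_nbhs_nbhs (conj oO (conj Jt ct)).
  by apply: filterS => s [Js cs]; rewrite -(smooth_curve_velocity sg).
apply: (@continuous_comp _ _ _ (fun s => (coord c (g s), 'D_1 (coord c \o g) s)) (tinv c)).
  have c1 : {for t, continuous (coord c \o g)} by apply: (smooth_on_continuous (sg.2 c)).
  have c2 : {for t, continuous ('D_1 (coord c \o g))}.
    have sd := smooth_on_derive (1 : R) (sg.2 c).
    exact: (smooth_on_continuous sd (conj Jt ct)).
  exact: (cvg_pair c1 c2).
by apply: tinv_continuous; split => //=; exact: chart_imgP.
Qed.

Lemma velocity_affine J g (p w t : R) : smooth_curve_on J g -> J (p + t * w) ->
  velocity (fun s => g (p + s * w)) t =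
  ((g (p + t * w), w *: (velocity g (p + t * w)).2) : tangent M).
Proof.
move=> sg Jt; rewrite /velocity/=; congr (_, _).
set c := chart_at _; set a := fun s => p + s * w.
have -> : coord c \o (fun s => g (p + s * w)) = (coord c \o g) \o a by [].
have da : is_derive t (1 : R) a w := is_derive_affine p w t.
have dg : differentiable (coord c \o g) (a t).
  by apply: smooth_curve_differentiable sg Jt _; exact: dom_chart_at.
have dfa : differentiable a t by apply/derivable1_diffP; exact: ex_derive.
rewrite (derive_comp _ dfa dg) derive_val.
by rewrite -[X in 'D_X _ _]mulr1 -[X in 'D_X _ _]/(w *: (1 : R)) deriveZv.
Qed.

Lemma smooth_curve_affine J g (p w : R) : open J -> smooth_curve_on J g ->
  smooth_curve_on [set t | J (p + t * w)] (fun s => g (p + s * w)).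
Proof.
move=> oJ sg.
have ca := @affine_continuous R p w.
split => [t Jt|c].
  by apply: (continuous_comp (ca t)); exact: sg.1.
have oO := curve_dom_open oJ sg.1 (dom_open c).
have h := smooth_on_line (p := p) (w := w) oO (sg.2 c).
exact h.
Qed.

End SmoothCurves.

Section Distance.
Context {R : realType} {n : nat} {M : riemannian R n}.
Implicit Types (g : R -> M) (J : set R).
Local Notation mu := lebesgue_measure.

Lemma clamp_itv (a b t : R) : a <= b -> a <= clamp a b t <= b.
Proof. by move=> ab; rewrite /clamp le_max lexx/= ge_max ab/= ge_min lexx. Qed.

Lemma clamp_id (a b t : R) : a <= t <= b -> clamp a b t = t.
Proof. by move=> /andP[ta tb]; rewrite /clamp (min_idPr tb) (max_idPr ta). Qed.

(** A primitive of the speed: it turns estimates on lengths into estimates on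
    derivatives. *)
Lemma speed_primitive J g (s t : R) : open J -> smooth_curve_on J g ->
  s <= t -> `[s, t] `<=` J ->
  exists F : R -> R,
    (forall u, s <= u <= t -> is_derive u (1 : R) F (tnorm (velocity g u))) /\
    (forall u v, s <= u -> u <= v -> v <= t ->
      (\int[mu]_(x in `[u, v]) (tnorm (velocity g x))%:E = (F v - F u)%:E)%E).
Proof.
move=> oJ sg st stJ.
pose f u := tnorm (velocity g (clamp s t u)).
have cf : continuous f.
  move=> u; apply: (@continuous_comp _ _ _ (fun u => velocity g (clamp s t u)) (@tnorm R n M)).
    apply: (@continuous_comp _ _ _ (clamp s t) (velocity g)); first exact: clamp_continuous.
    by apply: velocity_continuous oJ sg _; apply: stJ; rewrite /= in_itv/= clamp_itv.
  exact: tnorm_continuous.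
have fE u : s <= u <= t -> f u = tnorm (velocity g u) by move=> su; rewrite /f clamp_id.
have [F dF] := primitive_exists (s - 1) cf; exists F; split => [u sut|u v su uv vt].
  by rewrite -fE//; apply: dF; rewrite ltrBlDr (le_lt_trans (andP sut).1)// ltrDl.
transitivity (\int[mu]_(x in `[u, v]) (f x)%:E)%E.
  apply: eq_integral => x; rewrite inE/= in_itv/= => /andP[ux xv]; rewrite fE//.
  by rewrite (le_trans su)//= (le_trans xv).
apply: integral_primitive => // x /andP[ux xv]; apply: dF; rewrite ltrBlDr (le_lt_trans su)//.
by rewrite (le_lt_trans ux)// ltrDl.
Qed.

(** Affine change of parameter. Running a curve backwards is allowed, which
    yields the symmetry of the distance. *)
Lemma smooth_reparam J g (s t u v : R) : open J -> smooth_curve_on J g ->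
  s <= u <= t -> s <= v <= t -> `[s, t] `<=` J ->
  exists h : R -> M, [/\ smooth_curve 0 1 h, h 0 = g u, h 1 = g v &
    seg_length h = (\int[mu]_(x in `[Num.min u v, Num.max u v]) (tnorm (velocity g x))%:E)%E].
Proof.
move=> oJ sg /andP[su ut] /andP[sv vt] stJ.
pose w := v - u; pose h (x : R) := g (u + x * w).
have st : s <= t by exact: le_trans ut.
have [F [dF iF]] := speed_primitive oJ sg st stJ.
have inJ (x : R) : 0 <= x <= 1 -> s <= u + x * w <= t.
  by move=> x01; rewrite /w; apply/andP; split; nra.
exists h; split.
- exists [set x | J (u + x * w)]; last exact: smooth_curve_affine.
  split; last by move=> x /=; rewrite in_itv/= => x01; apply: stJ; rewrite /= in_itv/=; exact: inJ.
  by apply: (@open_comp _ _ (fun x : R => u + x * w)) => // x _; exact: affine_continuous.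
- by rewrite /h mul0r addr0.
- by rewrite /h mul1r /w addrC subrK.
rewrite iF; last 3 first.
- by rewrite le_min su.
- by rewrite le_max ge_min lexx.
- by rewrite ge_max ut.
have [G [dG iG]] := speed_primitive (J := [set x | J (u + x * w)]) (g := h) (s := 0) (t := 1)
  (@open_comp _ _ (fun x : R => u + x * w) _ (fun x _ => @affine_continuous R u w x) oJ)
  (smooth_curve_affine u w oJ sg) ler01
  (fun x x01 => stJ _ (inJ x ltac:(by move: x01; rewrite /= in_itv))).
rewrite /seg_length iG//; congr EFin.
(* The speed of [h] is [`|w|] times that of [g], and [`|w| = Num.sg w * w];
   so the derivatives of the two sides agree. *)
have sF : G 1 - G 0 = Num.sg w * (F v - F u).
  pose D x := G x - Num.sg w * F (u + x * w).
  have dD (x : R) : 0 <= x <= 1 -> is_derive x (1 : R) D 0.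
    move=> x01; have d1 := dG x x01; have d2 := dF _ (inJ x x01).
    have da := is_derive_affine u w x.
    have d3 : is_derive x (1 : R) (F \o (fun x => u + x * w)) (tnorm (velocity g (u + x * w)) * w).
      exact: is_derive1_comp.
    have d4 := is_deriveB d1 (is_deriveZ (Num.sg w) d3).
    have E : tnorm (velocity h x) - Num.sg w *: (tnorm (velocity g (u + x * w)) * w) = 0.
      rewrite /h (velocity_affine sg); last by apply: stJ; rewrite /= in_itv/=; exact: inJ.
      rewrite tnormZ normrEsg.
      by rewrite -[X in X = 0]/(Num.sg w * w * tnorm (velocity g (u + x * w)) -
        Num.sg w * (tnorm (velocity g (u + x * w)) * w)); ring.
    by move: d4; rewrite E.
  have [||c _] := @MVT_segment R D (cst 0) 0 1 ler01.
  - by move=> x; rewrite in_itv/= => /andP[x0 x1]; apply: dD; rewrite !ltW.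
  - apply: continuous_in_subspaceT => x; rewrite inE/= in_itv/= => /dD dx.
    by apply: differentiable_continuous; apply/derivable1_diffP; exact: ex_derive.
  rewrite mul0r /D mul0r mul1r addr0 /w [u + _]addrC subrK -/w => /eqP.
  by rewrite mulrBr; lra.
rewrite sF; have [uv|vu] := leP u v.
  move: uv; rewrite le_eqVlt => /predU1P[->|uv]; first by rewrite !subrr mulr0.
  by rewrite gtr0_sg ?mul1r// /w subr_gt0.
by rewrite ltr0_sg ?mulN1r ?opprB// /w subr_lt0.
Qed.

Lemma seg_length_fin g : smooth_curve 0 1 g -> exists2 r : R, 0 <= r & seg_length g = r%:E.
Proof.
move=> [J [oJ J01] sg]; have [F [dF iF]] := speed_primitive oJ sg ler01 J01.
exists (F 1 - F 0); last by rewrite -iF.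
rewrite -lee_fin -iF//; apply: integral_ge0 => x _; rewrite lee_fin; exact: tnorm_ge0.
Qed.

Lemma pw_path_fin (x y : M) l : pw_path x y l -> exists2 r : R, 0 <= r & l = r%:E.
Proof.
elim => [z|g z l' sg _ [r r0 ->]]; first by exists 0.
by have [s s0 ->] := seg_length_fin sg; exists (s + r); rewrite ?addr_ge0// EFinD.
Qed.

Lemma pw_path_cat (x y z : M) l m : pw_path x y l -> pw_path y z m -> pw_path x z (l + m)%E.
Proof.
move=> xy; elim: xy m => [w m|g w l' sg _ IH m zm]; first by rewrite add0e.
by rewrite -addeA; apply: pw_path_cons => //; exact: IH.
Qed.

Lemma pw_path1 g : smooth_curve 0 1 g -> pw_path (g 0) (g 1) (seg_length g).
Proof. by move=> sg; rewrite -[seg_length g]adde0; apply: pw_path_cons => //; exact: pw_path_nil. Qed.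

Lemma pw_path_rev (x y : M) l : pw_path x y l -> pw_path y x l.
Proof.
elim => [z|g z l' [J [oJ J01] sg] _ IH]; first exact: pw_path_nil.
have h00 : is_true ((0 : R) <= (0 : R) <= (1 : R)) by rewrite lexx ler01.
have h11 : is_true ((0 : R) <= (1 : R) <= (1 : R)) by rewrite lexx ler01.
have [h [sh h0 h1 hl]] := smooth_reparam oJ sg h11 h00 J01.
rewrite addeC; apply: pw_path_cat IH _.
rewrite -h0 -h1 (_ : seg_length g = seg_length h); first exact: pw_path1.
by rewrite hl minC maxC /Num.min /Num.max ltr01.
Qed.

Lemma pw_path_curve J g (s t u v : R) : open J -> smooth_curve_on J g ->
  s <= u <= t -> s <= v <= t -> `[s, t] `<=` J ->
  pw_path (g u) (g v) (\int[mu]_(x in `[Num.min u v, Num.max u v]) (tnorm (velocity g x))%:E)%E.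
Proof.
move=> oJ sg ut vt stJ; have [h [sh <- <- <-]] := smooth_reparam oJ sg ut vt stJ.
exact: pw_path1.
Qed.

Lemma geodist_ge0 (x y : M) : (0 <= geodist x y)%E.
Proof. by apply/ereal_infP => l /= /pw_path_fin[r r0 ->]; rewrite lee_fin. Qed.

Lemma geodist_le (x y : M) l : pw_path x y l -> (geodist x y <= l)%E.
Proof. by move=> p; exact: ereal_inf_lbound. Qed.

Lemma geodist_refl (x : M) : geodist x x = 0%E.
Proof. by apply/eqP; rewrite eq_le geodist_ge0 andbT; apply: geodist_le; exact: pw_path_nil. Qed.

Lemma geodist_sym (x y : M) : geodist x y = geodist y x.
Proof. by congr ereal_inf; apply/seteqP; split => l /=; exact: pw_path_rev. Qed.

Lemma geodist_ltP (x y : M) (e : R) : (geodist x y < e%:E)%E ->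
  exists2 l : R, pw_path x y l%:E & l < e.
Proof.
move=> /ereal_inf_lt[l /= xyl le]; have [r _ lr] := pw_path_fin xyl.
by exists r; rewrite -?lr// -lte_fin -lr.
Qed.

Lemma geodist_tri (x y z : M) (d e : R) :
  (geodist x y < d%:E)%E -> (geodist y z < e%:E)%E -> (geodist x z < (d + e)%:E)%E.
Proof.
move=> /geodist_ltP[l xy ld] /geodist_ltP[m yz me].
apply: le_lt_trans (geodist_le (pw_path_cat xy yz)) _.
by rewrite -EFinD lte_fin ltrD.
Qed.

(** A curve that leaves a coordinate ball takes all intermediate coordinate
    distances before, and until it first reaches one of them its coordinate
    displacement is at most its length divided by [l]. *)
Section Exit.
Variables (x0 : M) (c : chart M) (r l : R).
Hypothesis l0 : 0 < l.
Hypothesis rP : forall p : 'rV[R]_n, `|p - coord c x0| <= r -> (coord c @` dom c) p.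
Hypothesis lP : forall p w : 'rV[R]_n, `|p - coord c x0| <= r ->
  l * `|w| <= tnorm (tinv c (p, w)).

Definition coord_ball (e : R) : set M := [set y | dom c y /\ `|coord c y - coord c x0| <= e].

(** The coordinate distance to [x0], continued by [r] outside the ball. The
    continuation is continuous because coordinate balls, being compact, are
    closed in [M]. *)
Let f (y : M) : R :=
  if `[< dom c y /\ `|coord c y - coord c x0| < r >] then `|coord c y - coord c x0| else r.

Let f_in y : dom c y -> `|coord c y - coord c x0| < r -> f y = `|coord c y - coord c x0|.
Proof. by move=> cy yr; rewrite /f asboolT. Qed.

Let f_lt y e : e <= r -> f y < e -> dom c y /\ `|coord c y - coord c x0| = f y.
Proof. by rewrite /f; case: asboolP => [[cy yr]//|_] er re; have := lt_le_trans re er; rewrite ltxx. Qed.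

Let f_le y : f y <= r.
Proof. by rewrite /f; case: asboolP => // -[_ /ltW]. Qed.

Lemma coord_norm_continuous y : dom c y -> {for y, continuous (fun y => `|coord c y - coord c x0|)}.
Proof.
move=> cy; apply: (@continuous_comp _ _ _ (fun y => coord c y - coord c x0)); last exact: norm_continuous.
exact: (cvgB (coord_continuous cy) (cvg_cst (coord c x0))).
Qed.

Lemma coord_ball_compact e : e <= r -> compact (coord_ball e).
Proof.
move=> er; rewrite (_ : coord_ball e = cinv c @` [set p | `|p - coord c x0| <= e]).
  apply: continuous_compact; last exact: rV_ball_compact.
  apply: continuous_in_subspaceT => p; rewrite inE/= => pe; apply: cinv_continuous.
  by apply: rP; exact: le_trans er.
apply/seteqP; split => [y [cy ye]|y [p /= pe <-]].
  by exists (coord c y) => //; rewrite coordK.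
have cp := rP (le_trans pe er).
by split; [exact: chart_img_dom|rewrite chart_imgK].
Qed.

Let f_continuous : continuous f.
Proof.
move=> y; have [[cy yr]|ny] := pselect (dom c y /\ `|coord c y - coord c x0| < r).
  apply: (@near_eq_continuous _ _ (fun y => `|coord c y - coord c x0|)).
    have h1 : \near y, dom c y by apply: open_nbhs_nbhs; split => //; exact: dom_open.
    have h2 : \forall y' \near y, `|coord c y' - coord c x0| < r.
      by apply: (cvgr_lt (`|coord c y - coord c x0|)) => //; exact: coord_norm_continuous.
    by apply: filterS2 h1 h2 => z cz zr; rewrite f_in.
  exact: coord_norm_continuous.
apply/cvgrPdist_lt => e e0.
have fy : f y = r by rewrite /f asboolF.
have : nbhs y (~` coord_ball (r - e)).
  apply: open_nbhs_nbhs; split.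
    apply: closed_openC; apply: compact_closed; first exact: mpoint_hausdorff.
    by apply: coord_ball_compact; rewrite gerBl ltW.
  by move=> -[cy ye]; apply: ny; split => //; apply: le_lt_trans ye _; rewrite gtrBl.
apply: filterS => z nz; rewrite fy ger0_norm ?subr_ge0// ltrBlDr -ltrBlDl.
rewrite ltNge; apply/negP => zr; apply: nz.
have [|cz E] := @f_lt z r (lexx _); first by rewrite (le_lt_trans zr)// gtrBl.
by split => //; rewrite E.
Qed.

Lemma segment_stays g (rho d : R) : smooth_curve 0 1 g -> coord_ball rho (g 0) ->
  rho + d < r -> 0 <= d -> (seg_length g <= (l * d)%:E)%E -> coord_ball (rho + d) (g 1).
Proof.
move=> [J [oJ J01] sg] [c0 g0] rdr d0 gl.
have [F [dF iF]] := speed_primitive oJ sg ler01 J01.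
have F1 : F 1 - F 0 <= l * d by rewrite -lee_fin -iF.
have Fmono u v : 0 <= u -> u <= v -> v <= 1 -> F u <= F v.
  move=> u0 uv v1; rewrite -subr_ge0 -lee_fin -iF//.
  by apply: integral_ge0 => x _; rewrite lee_fin; exact: tnorm_ge0.
pose h t := f (g (clamp 0 1 t)).
have ch : continuous h.
  move=> t; apply: (@continuous_comp _ _ _ (fun t => g (clamp 0 1 t)) f); last exact: f_continuous.
  apply: (@continuous_comp _ _ _ (clamp 0 1) g); first exact: clamp_continuous.
  by apply: sg.1; apply: J01; rewrite /= in_itv/= clamp_itv.
have hE t : 0 <= t <= 1 -> h t = f (g t) by move=> t01; rewrite /h clamp_id.
apply: contrapT => ng1.
have h1 : rho + d < h 1.
  rewrite hE ?lexx ?ler01// ltNge; apply/negP => g1; apply: ng1.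
  by have [|cz E] := @f_lt (g 1) r (lexx _); [exact: le_lt_trans rdr | split => //; rewrite E].
have h0 : h 0 <= rho.
  by rewrite hE ?lexx ?ler01// f_in// (le_lt_trans g0)// (le_lt_trans _ rdr)// lerDl.
(* If the end point is too far, [m] is a level crossed on the way; [t1] is the
   first time at which it is reached. *)
pose m := ((rho + d) + h 1) / 2.
have hr : h 1 <= r := f_le _.
have m1 : rho + d < m by rewrite /m; lra.
have m2 : m < h 1 by rewrite /m; lra.
pose A := `[0 : R, 1] `&` [set t | m <= h t].
have cA : compact A.
  apply: compact_closedI; first exact: segment_compact.
  exact: (closed_preimage ch (closed_ge (y := m))).
have [||t1 + t1min] := @compact_EVT_min R R id A _ cA.
- by exists 1; split; rewrite /= ?in_itv/= ?lexx ?ler01// ltW.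
- by apply: continuous_subspaceT => t; exact: cvg_id.
rewrite inE => -[/=]; rewrite in_itv/= => /andP[t10 t11] mt1.
have before t : 0 <= t -> t < t1 -> dom c (g t) /\ `|coord c (g t) - coord c x0| < m.
  move=> t0 tt1; have t01 : 0 <= t <= 1 by rewrite t0 ltW// (lt_le_trans tt1).
  have : h t < m.
    rewrite ltNge; apply/negP => mt; have := t1min t; rewrite inE => /(_ (conj _ mt)).
    by rewrite /= in_itv/= t01 => /(_ isT); rewrite leNgt tt1.
  rewrite hE// => fm; have [||cz E] := @f_lt (g t) m => //; first by lra.
  by split => //; rewrite E.
have bound t : 0 <= t -> t < t1 -> h t <= rho + d.
  move=> t0 tt1; have [ct tm] := before t t0 tt1.
  have t01 : 0 <= t <= 1 by rewrite t0 ltW// (lt_le_trans tt1).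
  rewrite hE// f_in//; last by lra.
  rewrite -(subrK (coord c (g 0)) (coord c (g t))) -addrA (le_trans (ler_normD _ _))//.
  rewrite [X in _ <= X]addrC; apply: lerD; last exact: g0.
  (* The norm is the largest absolute coordinate; each coordinate is compared
     with the primitive [F] of the speed. *)
  apply: norm_rV_le => // j.
  have dj u : 0 <= u <= t -> is_derive u (1 : R) (fun u => coord c (g u) 0 j) ('D_1 (coord c \o g) u 0 j).
    move=> /andP[u0 ut]; have [cu um] := before u u0 (le_lt_trans ut tt1).
    have Ju : J u by apply: J01; rewrite /= in_itv/= u0/= (le_trans ut)//; case/andP: t01.
    have du : derivable (coord c \o g) u 1.
      by apply/derivable1_diffP; exact: (smooth_curve_differentiable sg Ju cu).
    have dju : derivable (fun u => coord c (g u) 0 j) u 1 by move/derivable_mxP : du; exact.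
    by rewrite (derive_mx du) mxE; exact: derivableP.
  have speed u : 0 <= u <= t -> `|'D_1 (coord c \o g) u 0 j| <= l^-1 * tnorm (velocity g u).
    move=> /andP[u0 ut]; have [cu um] := before u u0 (le_lt_trans ut tt1).
    have Ju : J u by apply: J01; rewrite /= in_itv/= u0/= (le_trans ut)//; case/andP: t01.
    rewrite ler_pdivlMl// (smooth_curve_velocity sg Ju cu).
    apply: le_trans (lP _ _); last by lra.
    by rewrite ler_pM2l//; exact: coord_le_norm.
  have main (e : R) : `|e| = 1 -> e * (coord c (g t) 0 j - coord c (g 0) 0 j) <= d.
    move=> e1.
    pose D u := l^-1 * F u - e * (coord c (g u) 0 j).
    have dD u : 0 <= u <= t -> is_derive u (1 : R) D
        (l^-1 * tnorm (velocity g u) - e * 'D_1 (coord c \o g) u 0 j).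
      move=> u0t; have d1 := dj u u0t.
      have d2 : is_derive u (1 : R) F (tnorm (velocity g u)).
        by apply: dF; case/andP: u0t => -> /le_trans -> //; case/andP: t01.
      exact: (is_deriveB (is_deriveZ l^-1 d2) (is_deriveZ e d1)).
    have [||v + E] := @MVT_segment R D (fun u => l^-1 * tnorm (velocity g u) - e * 'D_1 (coord c \o g) u 0 j) 0 t t0.
    - by move=> u; rewrite in_itv/= => /andP[u0 ut]; apply: dD; rewrite !ltW.
    - apply: continuous_in_subspaceT => u; rewrite inE/= in_itv/= => /dD du.
      by apply: differentiable_continuous; apply/derivable1_diffP; exact: ex_derive.
    rewrite in_itv/= => v0t; have sv := speed v v0t.
    have : 0 <= D t - D 0.
      rewrite E subr0 mulr_ge0// subr_ge0 (le_trans _ sv)//.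
      by rewrite (le_trans (ler_norm _))// normrM e1 mul1r.
    rewrite /D => DD.
    have Ft : l^-1 * (F t - F 0) <= d.
      rewrite ler_pdivrMl//; apply: le_trans F1; rewrite lerB//.
      by apply: Fmono => //; case/andP: t01.
    rewrite mulrBr; rewrite mulrBr in Ft; lra.
  have sub : (coord c (g t) - coord c (g 0)) 0 j = coord c (g t) 0 j - coord c (g 0) 0 j.
    by rewrite !mxE.
  rewrite sub ler_norml; apply/andP; split.
    have := main (-1); rewrite normrN1 => /(_ erefl).
    by rewrite mulN1r lerNl.
  by have := main 1; rewrite normr1 mul1r => /(_ erefl).
(* Just before [t1] the distance is close to [m], hence above [rho + d]. *)
have t1p : 0 < t1.
  rewrite lt_neqAle t10 andbT; apply/eqP => t1E; rewrite -t1E in mt1.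
  by have := le_trans mt1 h0; lra.
have : nbhs t1 [set t | rho + d < h t].
  by apply: (cvgr_gt (h t1) (ch t1)); lra.
move=> /nbhs_ballP[e /= e0 eh].
pose t := Num.max 0 (t1 - e / 2).
have tt1 : t < t1 by rewrite /t gt_max t1p/= gtrBl divr_gt0.
have t0 : 0 <= t by rewrite /t le_max lexx.
have : rho + d < h t.
  apply: eh; rewrite -ball_normE/= gtr0_norm ?subr_gt0// ltrBlDr -ltrBlDl /t lt_max.
  by apply/orP; right; lra.
by rewrite ltNge bound.
Qed.

Lemma path_stays y z (L : R) (rho e : R) : pw_path y z L%:E -> coord_ball rho y ->
  L < l * (e - rho) -> e <= r -> coord_ball e z.
Proof.
move=> yz; move: {-2}L%:E (erefl L%:E) yz rho => L' EL yz.
elim: yz L EL => [w|g w l' sg wl IH] L EL rho Brho Ll er.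
  case: EL => EL; case: Brho => cw we; split => //; apply: le_trans we _.
  have : 0 < l * (e - rho) by rewrite (le_lt_trans _ Ll)// EL.
  by rewrite pmulr_rgt0// subr_gt0 => /ltW.
have [s s0 sE] := seg_length_fin sg; have [q q0 qE] := pw_path_fin wl.
move: EL; rewrite sE qE -EFinD => -[EL].
have lN0 : l != 0 by rewrite gt_eqF.
apply: (IH q qE (rho + s / l)) => //; last first.
  have -> : l * (e - (rho + s / l)) = l * (e - rho) - s by field.
  by rewrite ltrBrDr addrC EL.
apply: segment_stays => //.
- have : rho + s / l < e; last by move=> /lt_le_trans; apply.
  rewrite -ltrBrDl ltr_pdivrMr// mulrC; apply: le_lt_trans Ll; rewrite -EL lerDl//.
- by rewrite divr_ge0// ltW.
- by rewrite sE lee_fin mulrC divfK.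
Qed.

End Exit.

End Distance.

(** * Topology of the geodesic distance *)

(** Compactness as an induction principle: [A] is contained in a finite union
    of neighbourhoods that satisfy [P]. *)
Lemma compact_union_ind (T : ptopologicalType) (P : set T -> Prop) (A : set T) :
  P set0 -> (forall B C, P B -> P C -> P (B `|` C)) ->
  (forall B C, B `<=` C -> P C -> P B) ->
  (forall x, A x -> exists2 U, nbhs x U & P U) -> compact A -> P A.
Proof.
move=> P0 PU Psub Ploc cA.
have /choice[U UP] : forall x, exists U, A x -> nbhs x U /\ P U.
  move=> x; have [Ax|nAx] := pselect (A x); last by exists set0.
  by have [U xU PUx] := Ploc x Ax; exists U.
have : cover_compact A by rewrite -compact_cover.
move=> /(_ T A (fun x => (U x)^°))[|x Ax|D DA AD].
- by move=> x _; exact: open_interior.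
- by exists x => //; exact: (UP x Ax).1.
have PUi x : A x -> P ((U x)^°).
  by move=> /UP[_]; apply: Psub; exact: interior_subset.
apply: Psub AD _; rewrite /cover bigcup_fset.
rewrite big_seq; elim/big_ind: _ => // x xD.
by apply: PUi; have := DA _ xD; rewrite inE.
Qed.

Section DistanceTopology.
Context {R : realType} {n : nat} {M : riemannian R n}.
Implicit Types (x y z : M).

(** Leaving a coordinate ball costs a length bounded below. *)
Lemma geodist_nbhs x (U : set M) : nbhs x U ->
  exists2 e : R, 0 < e & forall y, (geodist x y < e%:E)%E -> U y.
Proof.
move=> /chart_ball[c [r [l [B [cx [r0 l0 B0] rU lB]]]]].
exists (l * r); first exact: mulr_gt0.
move=> y /geodist_ltP[L xy Lr].
have [||||cy yr] := @path_stays R n M x c r l l0 _ _ x y L 0 r xy _ _ (lexx r).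
- by move=> p /rU[].
- by move=> p w /(lB p w)/andP[].
- by split => //; rewrite subrr normr0.
- by rewrite subr0.
by have [_] := rU _ yr; rewrite coordK.
Qed.

Lemma smooth_chart_line (c : chart M) (p w : 'rV[R]_n) :
  smooth_curve_on [set t : R | (coord c @` dom c) (p + t *: w)] (fun t => cinv c (p + t *: w) : M).
Proof.
have cl : continuous (fun t : R => p + t *: w).
  by move=> t; apply: cvgD; [exact: cvg_cst | apply: cvgZr_tmp; exact: cvg_id].
split => [t ct|d].
  apply: (@continuous_comp _ _ _ (fun t : R => p + t *: w) (cinv c)); first exact: cl.
  exact: cinv_continuous ct.
have oO := @overlap_open R n M c _ (dom_open d).
have sm := smooth_on_line (p := p) (w := w) oO (@transition_smooth _ _ M c d).
apply: smooth_on_sub sm => t [ct dt].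
have : ((coord c @` dom c) `&` cinv c @^-1` dom d) (p + t *: w) by [].
by rewrite -overlapE.
Qed.

(** The coordinate segment is a competitor. *)
Lemma geodist_chart_le (c : chart M) (p0 p q : 'rV[R]_n) (r B : R) :
  (forall p, `|p - p0| <= r -> (coord c @` dom c) p) ->
  (forall p w : 'rV[R]_n, `|p - p0| <= r -> tnorm (tinv c (p, w)) <= B * `|w|) ->
  `|p - p0| <= r -> `|q - p0| <= r ->
  (geodist (cinv c p) (cinv c q) <= (B * `|q - p|)%:E)%E.
Proof.
move=> rc BP pr qr; pose w := q - p.
pose g (t : R) : M := cinv c (p + t *: w); pose J := [set t : R | (coord c @` dom c) (p + t *: w)].
have inball t : 0 <= t <= 1 -> `|p + t *: w - p0| <= r.
  move=> /andP[t0 t1].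
  have -> : p + t *: w - p0 = (1 - t) *: (p - p0) + t *: (q - p0).
    by apply/rowP => j; rewrite !mxE; ring.
  rewrite (le_trans (ler_normD _ _))// !normrZ ger0_norm ?subr_ge0// ger0_norm//.
  have -> : r = (1 - t) * r + t * r by ring.
  by rewrite lerD// ler_wpM2l// subr_ge0.
have sg : smooth_curve_on J g := smooth_chart_line c p w.
have oJ : open J.
  apply: (@open_comp _ _ (fun t : R => p + t *: w)); last exact: img_open.
  by move=> t _; apply: cvgD; [exact: cvg_cst | apply: cvgZr_tmp; exact: cvg_id].
have J01 : `[0, 1] `<=` J by move=> t; rewrite /= in_itv/= => /inball/rc.
have sc : smooth_curve 0 1 g by exists J.
have -> : cinv c p = g 0 by rewrite /g scale0r addr0.
have -> : cinv c q = g 1 by rewrite /g scale1r /w addrC subrK.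
apply: le_trans (geodist_le (pw_path1 sc)) _.
have [F [dF iF]] := speed_primitive oJ sg ler01 J01.
rewrite /seg_length iF// lee_fin.
have [||t + E] := @MVT_segment R F (fun t => tnorm (velocity g t)) 0 1 ler01.
- by move=> t; rewrite in_itv/= => /andP[t0 t1]; apply: dF; rewrite !ltW.
- apply: continuous_in_subspaceT => t; rewrite inE/= in_itv/= => /dF dt.
  by apply: differentiable_continuous; apply/derivable1_diffP; exact: ex_derive.
rewrite in_itv/= => t01; rewrite E subr0 mulr1.
have ct := rc _ (inball t t01).
rewrite (smooth_curve_velocity (c := c) sg) ?/g; first last.
- exact: chart_img_dom.
- exact: ct.
rewrite chart_imgK// (_ : 'D_1 _ t = w); first by apply: BP; exact: inball.
have -> : 'D_1 (coord c \o g) t = 'D_1 (fun t : R => id (p + t *: w)) t.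
  apply: near_eq_derive; have := open_nbhs_nbhs (conj oJ ct).
  by apply: filterS => s Js; rewrite /g/= chart_imgK.
have di : derivable (id : 'rV[R]_n -> 'rV[R]_n) (p + t *: w) w by exact: derivable_id.
have d := is_derive_line di.
by rewrite derive_val derive_id.
Qed.

Lemma geodist_near2 x (e : R) : 0 < e ->
  exists2 V : set M, nbhs x V & forall y z, V y -> V z -> (geodist y z < e%:E)%E.
Proof.
move=> e0; have [c [r [l [B [cx [r0 l0 B0] rU lB]]]]] := chart_ball (@filterT _ (nbhs x) _).
pose d := Num.min r (e / (4 * B)).
have d0 : 0 < d by rewrite lt_min r0 divr_gt0// mulr_gt0.
exists [set y | dom c y /\ `|coord c y - coord c x| < d].
  apply: filterI; first by apply: open_nbhs_nbhs; split => //; exact: dom_open.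
  apply: (cvgr_lt (`|coord c x - coord c x|)); first exact: coord_norm_continuous.
  by rewrite subrr normr0.
move=> y z [cy yd] [cz zd].
have [yr zr] : `|coord c y - coord c x| <= r /\ `|coord c z - coord c x| <= r.
  by split; apply: ltW; apply: lt_le_trans (_ : d <= r) => //; rewrite ge_min lexx.
rewrite -(coordK cy) -(coordK cz).
apply: le_lt_trans (@geodist_chart_le c (coord c x) _ _ r B _ _ yr zr) _.
- by move=> p /rU[].
- by move=> p w /(lB p w)/andP[].
rewrite lte_fin.
have : `|coord c z - coord c y| < e / (4 * B) + e / (4 * B).
  rewrite -(subrK (coord c x) (coord c z)) -addrA (le_lt_trans (ler_normD _ _))//.
  rewrite ltrD//; last rewrite distrC.
    by apply: lt_le_trans zd _; rewrite ge_min lexx orbT.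
  by apply: lt_le_trans yd _; rewrite ge_min lexx orbT.
move=> zy; apply: (@lt_trans _ _ (B * (e / (4 * B) + e / (4 * B)))); first by rewrite ltr_pM2l.
have -> : B * (e / (4 * B) + e / (4 * B)) = e / 2 by field; rewrite gt_eqF.
by rewrite ltr_pdivrMr// ltr_pMr// ltr1n.
Qed.

Lemma geodist_near x (e : R) : 0 < e -> \forall y \near x, (geodist x y < e%:E)%E.
Proof.
move=> /(geodist_near2 x)[V xV VV]; apply: filterS (xV) => y.
by apply: VV; exact: nbhs_singleton.
Qed.

Lemma locally_compact x : exists2 K : set M, nbhs x K & compact K.
Proof.
have [c [r [l [B [cx [r0 l0 B0] rU lB]]]]] := chart_ball (@filterT _ (nbhs x) _).
exists (coord_ball x c r).
  apply: filterI; first by apply: open_nbhs_nbhs; split => //; exact: dom_open.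
  have cn := coord_norm_continuous (x0 := x) cx.
  have : \forall y \near x, `|coord c y - coord c x| < r.
    by apply: (cvgr_lt _ cn); rewrite subrr normr0.
  by apply: filterS => y /ltW.
by apply: (@coord_ball_compact R n M x c r) => // p /rU[].
Qed.

(** By the intermediate value theorem for the length of initial pieces. Cutting
    almost minimizing paths replaces the use of minimizing geodesics. *)
Lemma geodist_split x z (d e : R) : 0 < d -> 0 < e -> (geodist x z < (d + e)%:E)%E ->
  exists y, (geodist x y < d%:E)%E /\ (geodist y z < e%:E)%E.
Proof.
move=> + e0 /geodist_ltP[L xz Lde].
move: {-2}L%:E (erefl L%:E) xz Lde => L' EL xz.
elim: xz L EL d => [w|g w l' [J [oJ J01] sg] gw IH] L EL d Lde d0.
  by exists w; rewrite !geodist_refl !lte_fin.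
have [q q0 qE] := pw_path_fin gw.
have [F [dF iF]] := speed_primitive oJ sg ler01 J01.
have sE : seg_length g = (F 1 - F 0)%:E by rewrite /seg_length iF.
move: EL; rewrite sE qE -EFinD => -[EL].
have pc (u v : R) : 0 <= u -> u <= v -> v <= 1 -> pw_path (g u) (g v) (F v - F u)%:E.
  move=> u0 uv v1; rewrite -iF//.
  have := @pw_path_curve R n M J g 0 1 u v oJ sg.
  rewrite (min_idPl uv) (max_idPr uv); apply => //; apply/andP; split => //.
    exact: le_trans v1.
  exact: le_trans uv.
have [d1|d1] := ltP (F 1 - F 0) d.
  have [||y [gy yw]] := IH q qE (d - (F 1 - F 0)); [lra|lra|].
  exists y; split => //; have -> : d = (F 1 - F 0 + (d - (F 1 - F 0))) by ring.
  have [m gy' md] := geodist_ltP gy.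
  apply: le_lt_trans (geodist_le (pw_path_cat (pc _ _ _ _ _) gy')) _ => //.
  by rewrite -EFinD lte_fin ltrD2l.
have cF : {within `[0, 1], continuous F}.
  apply: continuous_in_subspaceT => t; rewrite inE/= in_itv/= => /dF dt.
  by apply: differentiable_continuous; apply/derivable1_diffP; exact: ex_derive.
have [m m0 [md Lm]] : exists2 m, 0 < m & m < d /\ L < m + e.
  exists (Num.max (d / 2) (d - ((d + e) - L) / 2)); first by rewrite lt_max divr_gt0.
  split; first by rewrite gt_max; apply/andP; split; lra.
  rewrite -ltrBlDr lt_max; apply/orP; right; lra.
have [|t + Ft] := @IVT R F 0 1 (F 0 + m) ler01 cF.
  have F01 : F 0 <= F 1 by lra.
  by rewrite (min_idPl F01) (max_idPr F01); apply/andP; split; lra.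
rewrite in_itv/= => /andP[t0 t1].
exists (g t); split.
  apply: le_lt_trans (geodist_le (pc 0 t _ _ _)) _ => //.
  by rewrite Ft lte_fin; lra.
have path2 := pw_path_cat (pc t 1 t0 t1 (lexx 1)) gw.
apply: le_lt_trans (geodist_le path2) _.
by rewrite qE Ft -EFinD lte_fin; lra.
Qed.

(** * Hopf-Rinow *)

Section HopfRinow.
Variables (Mcomplete : complete_manifold M) (K : set M) (K_compact : compact K).

(** The sublevel set [dist y K <= r], written without the infimum over [K]; it is
    empty for [r < 0]. *)
Definition closed_nbhd (r : R) : set M :=
  [set y | forall d : R, 0 < d -> exists2 x, K x & (geodist x y < (r + d)%:E)%E].

Lemma closed_nbhd_sub r s : r <= s -> closed_nbhd r `<=` closed_nbhd s.
Proof.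
move=> rs y yr d d0; have [x Kx xy] := yr d d0; exists x => //.
by apply: lt_le_trans xy _; rewrite lee_fin lerD2r.
Qed.

Lemma closed_nbhd_closed r : closed (closed_nbhd r).
Proof.
move=> y yr d d0; have d20 : 0 < d / 2 by rewrite divr_gt0.
have [z [zr yz]] := yr _ (geodist_near y d20).
have [x Kx xz] := zr _ d20; exists x => //.
have -> : r + d = r + d / 2 + d / 2 by field.
by apply: geodist_tri xz _; rewrite geodist_sym.
Qed.

Lemma closed_nbhd_neg r : r < 0 -> closed_nbhd r = set0.
Proof.
move=> r0; apply/seteqP; split => // y /(_ (- r)); rewrite oppr_gt0 => /(_ r0)[x _].
by rewrite subrr ltNge geodist_ge0.
Qed.

(** Local compactness, uniform along a compact set. *)
Lemma compact_fat (A : set M) : compact A ->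
  exists2 d : R, 0 < d & exists2 B : set M, compact B &
    forall x y, A x -> (geodist x y < d%:E)%E -> B y.
Proof.
pose P (A : set M) := exists2 d : R, 0 < d & exists2 B : set M, compact B &
    forall x y, A x -> (geodist x y < d%:E)%E -> B y.
apply: (@compact_union_ind _ P).
- by exists 1 => //; exists set0; [exact: compact0|].
- move=> A1 A2 [d1 d10 [B1 cB1 AB1]] [d2 d20 [B2 cB2 AB2]].
  exists (Num.min d1 d2); first by rewrite lt_min d10.
  exists (B1 `|` B2); first exact: compactU.
  move=> x y + xy; case=> [/AB1|/AB2] h; [left|right]; apply: h; apply: lt_le_trans xy _;
    by rewrite lee_fin ge_min lexx ?orbT.
- by move=> A1 A2 A12 [d d0 [B cB AB]]; exists d => //; exists B => // x y /A12; exact: AB.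
move=> x Ax; have [B nB cB] := locally_compact x; have [e e0 eB] := geodist_nbhs nB.
have e20 : 0 < e / 2 by rewrite divr_gt0.
exists [set y | (geodist x y < (e / 2)%:E)%E]; first exact: geodist_near.
exists (e / 2) => //; exists B => // y z xy yz.
by apply: eB; rewrite [e]splitr; exact: geodist_tri yz.
Qed.

(** Finitely many balls of radius [e] cover [A], so the hypothesis puts [G] on the
    union of as many balls of radius [e + e], hence on one of them. *)
Lemma ultra_ball (G : set_system M) (A : set M) (e : R) : UltraFilter G -> compact A -> 0 < e ->
  G [set z | exists2 y, A y & (geodist y z < e%:E)%E] ->
  exists y, G [set z | (geodist y z < (e + e)%:E)%E].
Proof.
move=> uG cA e0.
apply: (@compact_union_ind _ (fun A => G [set z | exists2 y, A y & (geodist y z < e%:E)%E] ->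
  exists y, G [set z | (geodist y z < (e + e)%:E)%E])) cA.
- move=> G0; have : G set0 by apply: filterS G0 => z [].
  by move=> /filter_not_empty.
- move=> A1 A2 h1 h2 G12.
  have [/h1//|GC] := in_ultra_setVsetC [set z | exists2 y, A1 y & (geodist y z < e%:E)%E] uG.
  apply: h2; apply: filterS (filterI G12 GC) => z [[y [A1y|A2y] yz] nA1]; last by exists y.
  by exfalso; apply: nA1; exists y.
- by move=> A1 A2 A12 h G1; apply: h; apply: filterS G1 => z [y /A12 Ay yz]; exists y.
move=> x _; exists [set y | (geodist x y < e%:E)%E]; first exact: geodist_near.
move=> Gx; exists x; apply: filterS Gx => z [y /= xy yz]; exact: geodist_tri yz.
Qed.

(** A point at distance [r] from [K] is close to the neighbourhood of a slightly
    smaller radius, which is compact. Hence an ultrafilter on the neighbourhood of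
    radius [r] charges arbitrarily small balls; points chosen in finite
    intersections of these balls form a Cauchy sequence, and its limit is the
    limit of the ultrafilter. *)
Lemma closed_nbhd_limit r : (forall s, s < r -> compact (closed_nbhd s)) ->
  compact (closed_nbhd r).
Proof.
move=> cs; rewrite compact_ultra => G uG Gr.
have step (e : R) : 0 < e -> exists y, G [set z | (geodist y z < (e + e)%:E)%E].
  move=> e0; apply: (@ultra_ball G (K `|` closed_nbhd (r - e / 4))) => //.
    by apply: compactU => //; apply: cs; rewrite gtrBl divr_gt0.
  apply: filterS Gr => y /(_ (e / 4))[|x Kx xy]; first by rewrite divr_gt0.
  have [re|re] := leP r (e / 4).
    exists x; first by left.
    apply: lt_le_trans xy _; rewrite lee_fin; lra.
  have [||| z [xz zy]] := @geodist_split x y (r - e / 4) (e / 2); [lra|lra| |].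
    by rewrite (_ : _ + _ = r + e / 4)//; field.
  exists z; last by apply: lt_le_trans zy _; rewrite lee_fin; lra.
  right => d d0; exists x => //; apply: lt_le_trans xz _; rewrite lee_fin; lra.
have {}step k : exists y, G [set z | (geodist y z < (k.+1%:R^-1)%:E)%E].
  have [|y] := step (k.+1%:R^-1 / 2); first by rewrite divr_gt0.
  by rewrite -splitr; exists y.
have [y yG] := choice step.
have inter k : G [set z | forall j, (j <= k)%N -> (geodist (y j) z < (j.+1%:R^-1)%:E)%E].
  elim: k => [|k IH]; first by apply: filterS (yG 0) => z ? j; rewrite leqn0 => /eqP ->.
  apply: filterS (filterI IH (yG k.+1)) => z [h1 h2] j.
  by rewrite leq_eqVlt => /predU1P[->//|]; rewrite ltnS; exact: h1.
have /choice[u uP] : forall k, exists z, forall j, (j <= k)%N -> (geodist (y j) z < (j.+1%:R^-1)%:E)%E.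
  by move=> k; have /filter_ex[z] := inter k; exists z.
have [x ux] : exists x : M, geodist (u k) x @[k --> \oo] --> 0%E.
  apply: Mcomplete => e e0.
  have e20 : 0 < e / 2 by rewrite divr_gt0.
  have [k _ ke] := near_infty_natSinv_lt (PosNum e20).
  have small j : (k <= j)%N -> (geodist (y k) (u j) < (e / 2)%:E)%E.
    by move=> kj; apply: lt_trans (uP j k kj) _; rewrite lte_fin; exact: (ke k (leqnn k)).
  exists k => i j ki kj; rewrite [e]splitr.
  by apply: geodist_tri (small j kj); rewrite geodist_sym; exact: small.
have Gx : G --> x.
  move=> U /geodist_nbhs[e e0 eU].
  have e20 : 0 < e / 2 by rewrite divr_gt0.
  have e40 : 0 < e / 2 / 2 by rewrite divr_gt0.
  have h1 := near_infty_natSinv_lt (PosNum e40).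
  have h2 : \forall k \near \oo, (geodist (u k) x < (e / 2)%:E)%E.
    have : nbhs (0 : \bar R)%E [set t | (t < (e / 2)%:E)%E].
      by apply: open_nbhs_nbhs; split; [exact: open_ereal_lt_ereal | rewrite /= lte_fin].
    by move/ux.
  have [k [/= ke uk]] := filter_ex (filterI h1 h2).
  apply: filterS (yG k) => z /= yz; apply: eU.
  rewrite [e]splitr; apply: (@geodist_tri _ _ _ x (u k)); first by rewrite geodist_sym.
  rewrite [e / 2]splitr; apply: (@geodist_tri _ _ _ (u k) (y k)).
    by rewrite geodist_sym; apply: lt_trans (uP k k (leqnn k)) _; rewrite lte_fin.
  by apply: lt_trans yz _; rewrite lte_fin.
exists x; split => //; apply: closed_nbhd_closed => U xU.
by apply: (@filter_ex _ G); apply: filterI => //; exact: Gx.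
Qed.

(** The radii [r] with this property form an interval, closed by
    [closed_nbhd_limit]. If it had a finite end point [rho], then by [compact_fat]
    and [geodist_split] slightly larger radii would belong to it. *)
Theorem closed_nbhd_compact r : compact (closed_nbhd r).
Proof.
pose S := [set s | compact (closed_nbhd s)].
have down s t : s <= t -> S t -> S s.
  move=> st ct; apply: subclosed_compact ct (closed_nbhd_sub st).
  exact: closed_nbhd_closed.
apply: contrapT => nr.
have Sub : ubound S r.
  by move=> s Ss; rewrite leNgt; apply/negP => rs; apply: nr; apply: down Ss; exact: ltW.
have Sneg s : s < 0 -> S s by move=> s0; rewrite /S/= closed_nbhd_neg//; exact: compact0.
have hsS : has_sup S by split; [exists (-1); apply: Sneg; rewrite ltrN10 | exists r].
pose rho := sup S.
have rho0 : 0 <= rho.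
  rewrite leNgt; apply/negP => rho0.
  have := sup_upper_bound hsS (Sneg (rho / 2) _); rewrite -/rho; lra.
have Srho : compact (closed_nbhd rho).
  apply: closed_nbhd_limit => s /(sup_gt hsS.1)[t St st].
  by apply: down St; exact: ltW.
have [d d0 [B cB AB]] := compact_fat Srho.
have : S (rho + d / 4).
  apply: subclosed_compact cB _; first exact: closed_nbhd_closed.
  move=> y /(_ (d / 4))[|x Kx xy]; first by rewrite divr_gt0.
  have xrho : closed_nbhd rho x.
    by move=> e e0; exists x => //; rewrite geodist_refl lte_fin ltr_wpDl.
  move: rho0; rewrite le_eqVlt => /predU1P[rho0|rho0].
    apply: (AB x) => //; apply: lt_le_trans xy _; rewrite lee_fin -rho0; lra.
  have [||| z [xz zy]] := @geodist_split x y rho (d / 2) => //; first by rewrite divr_gt0.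
    by rewrite (_ : rho + d / 2 = rho + d / 4 + d / 4)//; field.
  apply: (AB z); last by apply: lt_le_trans zy _; rewrite lee_fin; lra.
  move=> e e0; exists x => //; apply: lt_le_trans xz _; rewrite lee_fin; lra.
move=> /(sup_upper_bound hsS); rewrite -/rho; lra.
Qed.

End HopfRinow.

End DistanceTopology.

(** * Selection for empirical measures on the line *)

Section Quantiles.
Context {R : realType}.
Local Notation mu := (@lebesgue_measure R).

Lemma measurable_within_comp (D : set R) (f : R -> R) (q : R -> R) :
  measurable D -> {within D, continuous f} -> measurable_fun setT q -> (forall t, D (q t)) ->
  measurable_fun setT (f \o q).
Proof.
move=> mD cf mq Dq; apply: (@measurable_comp _ _ _ _ _ _ D) => //.
  by move=> _ [t _ <-].
exact: subspace_continuous_measurable_fun.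
Qed.

Section OneSample.
Variables (N : nat) (x : 'I_N -> R).
Hypothesis N0 : (0 < N)%N.

Definition order_stat : seq R := sort <=%R [seq x i | i <- enum 'I_N].

(** For [0 <= t < 1] it has the law of a uniformly chosen entry; the minimum with
    [N.-1] keeps its values in the sample for [1 <= t]. *)
Definition quantile (t : R) : R :=
  nth 0 order_stat (minn (Num.truncn (t * N%:R)) N.-1).

Lemma size_order_stat : size order_stat = N.
Proof. by rewrite size_sort size_map size_enum_ord. Qed.

Lemma quantile_in t : exists i, quantile t = x i.
Proof.
have : quantile t \in order_stat.
  by apply: mem_nth; rewrite size_order_stat gtn_min ltn_predL N0 orbT.
by rewrite mem_sort => /mapP[i _ ->]; exists i.
Qed.

Lemma quantile_homo : {homo quantile : s t / s <= t}.
Proof.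
move=> s t st; apply: (sorted_leq_nth le_trans le_refl).
- exact: sort_le_sorted.
- by rewrite inE size_order_stat gtn_min ltn_predL N0 orbT.
- by rewrite inE size_order_stat gtn_min ltn_predL N0 orbT.
rewrite leq_min geq_minr andbT geq_min le_truncn// ler_wpM2r//.
Qed.

Lemma quantile_measurable : measurable_fun setT quantile.
Proof. by apply: nondecreasing_measurable => //; exact: quantile_homo. Qed.

Lemma quantile_le (B e t : R) : 0 <= t -> t < 1 - e ->
  (#|[pred i | B < x i]|%:R <= e * N%:R) -> quantile t <= B.
Proof.
move=> t0 te cB; rewrite leNgt; apply/negP => Bq.
pose k := minn (Num.truncn (t * N%:R)) N.-1.
have kN : (k < N)%N by rewrite /k gtn_min ltn_predL N0 orbT.
have : (N - k <= #|[pred i | (B < x i)%R]|)%N.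
  rewrite cardE size_filter.
  rewrite -enumT (_ : count _ _ = count (fun y => B < y) order_stat); last first.
    by rewrite /order_stat count_sort (count_map x) enumT.
  rewrite -{1}size_order_stat -size_drop -(cat_take_drop k order_stat) count_cat.
  apply: leq_trans (leq_addl _ _); rewrite drop_cat size_take size_order_stat kN ltnn subnn drop0.
  suff : all (fun y => B < y) (drop k order_stat) by rewrite all_count => /eqP ->.
  apply/(all_nthP 0) => j; rewrite size_drop size_order_stat => jN.
  rewrite nth_drop; apply: lt_le_trans Bq _.
  apply: (sorted_leq_nth le_trans le_refl) => //; rewrite ?inE ?size_order_stat ?leq_addr//.
  - exact: sort_le_sorted.
  - by rewrite -ltn_subRL.
rewrite -(ler_nat R) => /le_trans/(_ cB); rewrite natrB ?(ltnW kN)//.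
have : k%:R <= t * N%:R :> R.
  apply: (@le_trans _ _ (Num.truncn (t * N%:R))%:R); first by rewrite ler_nat geq_minl.
  by rewrite truncn_le mulr_ge0.
have : 0 < N%:R :> R by rewrite ltr0n.
nra.
Qed.

(** [quantile] is constant for [k / N <= t < k.+1 / N]. *)
Lemma integral_quantile (f : R -> R) : measurable_fun setT (f \o quantile) ->
  (\int[mu]_(t in `[0%R, 1%R]) (f (quantile t))%:E = (N%:R^-1 * \sum_i f (x i))%:E)%E.
Proof.
move=> mf.
have NR : 0 < N%:R :> R by rewrite ltr0n.
have mfE : measurable_fun setT (EFin \o (f \o quantile)) by apply/measurable_EFinP.
rewrite (_ : \sum_i f (x i) = \sum_(0 <= j < N) f (nth 0 order_stat j)); last first.
  rewrite -[N in \sum_(0 <= j < N) _]size_order_stat -(big_nth 0 predT f).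
  rewrite /order_stat (perm_big _ (permEl (perm_sort _ _))) big_map.
  by rewrite big_enum.
rewrite integral_itv_bndoo; last exact: measurable_funTS.
rewrite -(@integral_itv_bndoo _ 0 1 _ true true); last exact: measurable_funTS.
suff H k : (k <= N)%N -> (\int[mu]_(t in `[0%R, (k%:R / N%:R)%R[) (f (quantile t))%:E =
    (N%:R^-1 * \sum_(0 <= j < k) f (nth 0 order_stat j))%:E)%E.
  by rewrite -H// divff// gt_eqF.
elim: k => [_|k IH kN].
  by rewrite mul0r set_itvco0 integral_set0 big_geq// mulr0.
have kk : k%:R / N%:R <= k.+1%:R / N%:R :> R by rewrite ler_pM2r ?invr_gt0// ler_nat.
rewrite (@itv_bndbnd_setU _ _ _ (BLeft (k%:R / N%:R))) ?bnd_simp ?divr_ge0//.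
rewrite integral_setU//=; last 2 first.
- exact: measurable_funTS.
- rewrite disj_set2E; apply/eqP/seteqP; split => // t [] /=; rewrite !in_itv/= => /andP[_ +] /andP[+ _].
  by move=> /lt_le_trans h /h; rewrite ltxx.
rewrite IH ?(ltnW kN)// big_nat_recr//= mulrDr EFinD; congr (_ + _)%E.
transitivity (\int[mu]_(t in `[(k%:R / N%:R)%R, (k.+1%:R / N%:R)%R[) (cst (f (nth 0 order_stat k))%:E t))%E.
  apply: eq_integral => t; rewrite inE/= in_itv/= => /andP[t1 t2]; congr (f _)%:E.
  rewrite /quantile; congr nth.
  rewrite (@truncn_def _ _ k); last by rewrite -ler_pdivrMr// t1 -ltr_pdivlMr.
  by apply/minn_idPl; rewrite -ltnS prednK.
rewrite integral_cst//= lebesgue_measure_itv/= lte_fin ltr_pM2r ?invr_gt0// ltr_nat ltnSn.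
by rewrite -EFinB -EFinM -mulrBl -natrB// subSnn mul1r mulrC.
Qed.

End OneSample.

End Quantiles.

Section Diagonal.
Context {R : realType}.

Lemma increasing_seq_ge (f : nat -> nat) : increasing_seq f -> forall n, (n <= f n)%N.
Proof.
move=> fi; elim => // n IH; apply: leq_ltn_trans IH _.
by rewrite ltnNge; have := fi n.+1 n; rewrite leEnat => ->; rewrite ltnn.
Qed.

Lemma increasing_seq_lt (f : nat -> nat) : increasing_seq f -> {homo f : i j / (i < j)%N}.
Proof.
move=> fi i j ij; rewrite ltnNge; have := fi j i; rewrite leEnat => ->.
by rewrite -ltnNge.
Qed.

(** [sig q] extracts from [sig q.-1] by the Bolzano-Weierstrass theorem; the
    diagonal [k |-> sig k k] is eventually a subsequence of each [sig q]. *)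
Lemma diagonal_extraction (u : nat -> nat -> R) : (forall q, bounded_fun (u q)) ->
  exists2 s : nat -> nat, {homo s : i j / (i < j)%N} & forall q, cvgn (u q \o s).
Proof.
move=> bu.
have /choice[B BP] : forall v : nat -> R, exists f : nat -> nat,
    increasing_seq f /\ (bounded_fun v -> cvgn (v \o f)).
  move=> v; have [bv|nv] := pselect (bounded_fun v).
    by have [f fi fc] := bolzano_weierstrass bv; exists f.
  by exists id.
pose fix sig q : nat -> nat :=
  if q is q'.+1 then sig q' \o B (u q \o sig q') else B (u 0%N).
have sigS q : sig q.+1 = sig q \o B (u q.+1 \o sig q) by [].
have sig_incr q : increasing_seq (sig q).
  elim: q => [|q IH]; first exact: (BP _).1.
  move=> i j; rewrite sigS/=; set v := (u _ \o _ : nat -> R).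
  by transitivity (B v i <= B v j)%O; [exact: IH | exact: (BP v).1].
have bcomp (v : nat -> R) (f : nat -> nat) : bounded_fun v -> bounded_fun (v \o f).
  move=> [m [mr mv]]; exists m; split => // y my i _.
  exact: mv.
have sig_cvg q : cvgn (u q \o sig q).
  case: q => [|q]; first exact: (BP _).2.
  exact: ((BP (u q.+1 \o sig q)).2 (bcomp _ _ (bu q.+1))).
have factor q d : exists2 f : nat -> nat, increasing_seq f & sig (q + d)%N = sig q \o f.
  elim: d => [|d [f fi E]]; first by exists id; rewrite ?addn0.
  exists (f \o B (u (q + d).+1 \o sig (q + d)%N)); last by rewrite addnS sigS E.
  move=> i j /=; set v := (u _ \o _ : nat -> R).
  by transitivity (B v i <= B v j)%O; [exact: fi | exact: (BP v).1].
have later q k : (q <= k)%N -> exists2 i, (k <= i)%N & sig k k = sig q i.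
  move=> qk; have [f fi E] := factor q (k - q)%N.
  by exists (f k); [exact: increasing_seq_ge | rewrite -[X in sig X](subnKC qk) E].
exists (fun k => sig k k).
  move=> i j ij; have [m jm ->] := later i j (ltnW ij).
  by apply: increasing_seq_lt => //; exact: leq_trans jm.
move=> q; apply/cvg_ex; exists (limn (u q \o sig q)); apply/cvgrPdist_lt => e e0.
have /cvgrPdist_lt/(_ e e0)[N0 _ N0e] := sig_cvg q.
exists (maxn q N0) => // k /=; rewrite geq_max => /andP[qk Nk].
by have [i ki ->] := later q k qk; apply: N0e; exact: leq_trans ki.
Qed.

End Diagonal.

Section Helly.
Context {R : realType}.
Local Notation mu := (@lebesgue_measure R).

(** Rationals between the lower and the upper limit. They will number the times
    at which the quantile functions may fail to converge. *)
Lemma oscillation (v : nat -> R) (B : R) : (forall k, 0 <= v k <= B) -> ~ cvgn v ->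
  exists p q : rat, [/\ (p < q)%R, forall k, exists2 i, (k <= i)%N & v i < ratr p &
    forall k, exists2 i, (k <= i)%N & ratr q < v i].
Proof.
move=> vB nv; apply: contrapT => H; apply: nv.
pose S := [set r | exists k, forall i, (k <= i)%N -> r <= v i].
have S0 : S 0 by exists 0%N => i _; case/andP: (vB i).
have SB : ubound S B by move=> r [k /(_ k (leqnn k))] /le_trans; apply; case/andP: (vB k).
have hsS : has_sup S by split; [exists 0 | exists B].
apply/cvg_ex; exists (sup S); apply/cvgrPdist_lt => e e0.
have [p /[!in_itv]/= /andP[p1 p2]] := @rat_in_itvoo R (sup S) (sup S + e / 2) ltac:(by lra).
have [q /[!in_itv]/= /andP[q1 q2]] := @rat_in_itvoo R (ratr p) (sup S + e) ltac:(by lra).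
have [r [k1 rk] rS] := sup_adherent e0 hsS.
have [k2 k2q] : exists k, forall i, (k <= i)%N -> v i <= ratr q.
  apply: contrapT => nq; apply: H; exists p, q; split.
  - by rewrite -(ltr_rat R).
  - move=> k; apply: contrapT => nk.
    have : S (ratr p).
      exists k => i ki; rewrite leNgt; apply/negP => vi; apply: nk; by exists i.
    by move=> /(sup_upper_bound hsS); lra.
  - move=> k; apply: contrapT => nk; apply: nq; exists k => i ki.
    by rewrite leNgt; apply/negP => vi; apply: nk; exists i.
exists (maxn k1 k2) => // i /=; rewrite geq_max => /andP[/rk h1 /k2q h2].
rewrite ltr_norml; apply/andP; split; lra.
Qed.

(** Helly's selection theorem in Skorokhod's form. The quantile functions are
    monotone and, by tightness, bounded at each time [t < 1]; a diagonal
    subsequence converges at rational times. At another time [t] of divergence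
    they oscillate across two rationals, and by monotonicity two such times cannot
    share the same pair; so the divergence is confined to a countable set, and
    dominated convergence applies. *)
Theorem helly_selection (D : set R) (d0 : R) (x : forall N, 'I_N -> R) :
  closed D -> D d0 -> (forall N (i : 'I_N), D (x N i)) -> (forall N (i : 'I_N), 0 <= x N i) ->
  (forall e : R, 0 < e -> exists B : R, forall N, (0 < N)%N ->
    #|[pred i | (B < x N i)%R]|%:R <= e * N%:R) ->
  exists (s : nat -> nat) (Q : R -> R), [/\ {homo s : i j / (i < j)%N},
    measurable_fun setT Q, (forall t, D (Q t)) &
    forall (f : R -> R) (B : R), {within D, continuous f} -> (forall t, `|f t| <= B) ->
      (((s k)%:R^-1 * \sum_i f (x (s k) i))%:E @[k --> \oo] -->
       \int[mu]_(t in `[0%R, 1%R]) (f (Q t))%:E)%E].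
Proof.
move=> cD Dd0 xD x0 tight.
have /choice[Bd BdP] : forall t : R, exists B : R, 0 <= t < 1 -> forall N, (0 < N)%N ->
    quantile (x N) t <= B.
  move=> t; have [/andP[t0 t1]|//] := boolP (0 <= t < 1); last by exists 0.
  have [|B HB] := tight ((1 - t) / 2); first by rewrite divr_gt0// subr_gt0.
  exists B => _ N N0; apply: quantile_le t0 _ (HB N N0) => //; lra.
pose v N t := if (0 < N)%N then quantile (x N) t else d0.
have vD N t : D (v N t).
  by rewrite /v; case: ifPn => // N0; have [i ->] := quantile_in (x N) N0 t.
have vm N : measurable_fun setT (v N).
  by rewrite /v; case: (0 < N)%N / boolP => [N0|_]; [exact: quantile_measurable | exact: measurable_cst].
have vb t : 0 <= t < 1 -> forall N, 0 <= v N.+1 t <= Bd t.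
  move=> t01 N; rewrite /v ltn0Sn BdP// andbT.
  by have [i ->] := quantile_in (x N.+1) (ltn0Sn N) t.
have vmono N s t : s <= t -> v N s <= v N t.
  by rewrite /v; case: ifPn => // N0; exact: quantile_homo.
(* An enumeration of the rationals [r] with [0 <= r < 1]. *)
pose tau (q : nat) : R := if unpickle q is Some r then (if 0 <= (ratr r : R) < 1 then ratr r else 0) else 0.
have tau01 q : 0 <= tau q < 1.
  rewrite /tau; case: (unpickle q) => [r|]; last by rewrite lexx ltr01.
  by case: ifPn => // _; rewrite lexx ltr01.
have tau_dense s t : 0 <= s -> s < t -> t <= 1 -> exists q, s < tau q < t.
  move=> s0 st t1; have [r] := rat_in_itvoo st; rewrite in_itv/= => /andP[sr rt].
  exists (pickle r); rewrite /tau pickleK.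
  by rewrite (le_trans s0 (ltW sr))/= (lt_le_trans rt)// sr rt.
have [s s_lt s_cvg] : exists2 s : nat -> nat, {homo s : i j / (i < j)%N} &
    forall q, cvgn ((fun N => v N.+1 (tau q)) \o s).
  apply: (diagonal_extraction (u := fun q N => v N.+1 (tau q))) => q.
  exists (Bd (tau q)); split; first exact: num_real.
  move=> y /ltW By N _ /=; have /andP[v0 vB] := vb _ (tau01 q) N.
  by rewrite ger0_norm// (le_trans vB).
(* The sample of size 0 has no quantiles, whence the shift by one. *)
pose S k := (s k).+1.
pose E := [set t : R | 0 < t < 1 /\ cvgn (fun k => v (S k) t)].
pose Bad := [set t : R | 0 < t < 1 /\ ~ cvgn (fun k => v (S k) t)].
have cBad : countable Bad.
  have /choice[pq pqP] : forall t : R, exists pq : rat * rat, Bad t ->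
      [/\ (pq.1 < pq.2)%R, forall k, exists2 i, (k <= i)%N & v (S i) t < ratr pq.1 &
      forall k, exists2 i, (k <= i)%N & ratr pq.2 < v (S i) t].
    move=> t; have [[/andP[t0 t1] nc]|nb] := pselect (Bad t); last by exists (0, 0).
    have [k|p [q H]] := oscillation (v := fun k => v (S k) t) (B := Bd t) _ nc.
      by apply: vb; rewrite (ltW t0) t1.
    by exists (p, q).
  apply/countable_injP; exists (fun t => pickle (pq t)).
  (* At a rational time between [t] and [u] the limit would have to be both above
     [(pq t).2] and below [(pq t).1]. *)
  suff H t u : Bad t -> Bad u -> pq t = pq u -> ~ t < u.
    move=> t u; rewrite !inE => Bt Bu /(pcan_inj pickleK) e.
    by have [/(H t u Bt Bu e)|/(H u t Bu Bt (esym e))|] := ltgtP t u.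
  move=> Bt Bu e tu; have [[/andP[t0 t1] _] [/andP[u0 u1] _]] := (Bt, Bu).
  have [pq1 _ hi] := pqP t Bt; have [_ lo _] := pqP u Bu; rewrite -e in lo.
  have [q /andP[tq qu]] := tau_dense t u (ltW t0) tu (ltW u1).
  have /cvg_ex[/= l vl] := s_cvg q.
  have h1 : ratr (pq t).2 <= l.
    rewrite leNgt; apply/negP => lq.
    have [k _ kP] := cvgr_lt _ vl _ lq.
    have [i ki vi] := hi k; have := kP i ki => /=.
    by rewrite ltNge (le_trans (ltW vi))//; apply: vmono; exact: ltW.
  have h2 : l <= ratr (pq t).1.
    rewrite leNgt; apply/negP => lq.
    have [k _ kP] := cvgr_gt _ vl _ lq.
    have [i ki vi] := lo k; have := kP i ki => /=.
    by rewrite ltNge (le_trans _ (ltW vi))//; apply: vmono; exact: ltW.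
  by have := le_trans h1 h2; rewrite ler_rat leNgt pq1.
have mBad : measurable Bad by apply: countable_measurable => // t; exact: measurable_set1.
have muBad : mu Bad = 0%E := countable_lebesgue_measure0 cBad.
have EE : E = `]0, 1[ `\` Bad.
  apply/seteqP; split => t; rewrite /E /Bad/= in_itv/=.
    by move=> [t01 c]; split => // -[].
  by move=> [t01 nb]; split => //; apply: contrapT => nc; apply: nb.
have mE : measurable E by rewrite EE; apply: measurableD.
pose Q t := if t \in E then limn (fun k => v (S k) t) else d0.
have QE t : E t -> v (S k) t @[k --> \oo] --> Q t.
  by move=> Et; rewrite /Q mem_set//; case: Et.
have QD t : D (Q t).
  rewrite /Q; case: ifPn => [/set_mem Et|//].
  by apply: (closed_cvg D) (Et.2) => //; exact: nearW.
have mQ : measurable_fun setT Q.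
  rewrite -(setUv E); apply/measurable_funU => //; first exact: measurableC.
  split.
    apply: (measurable_fun_cvg (h := fun k => v (S k))) => // k.
    exact: measurable_funTS.
  apply: (eq_measurable_fun (cst d0)); last exact: measurable_cst.
  by move=> t; rewrite inE /Q => nE; rewrite memNset.
exists S, Q; split => //.
move=> f B cf fB.
have mD : measurable D := closed_measurable cD.
have mfQ : measurable_fun setT (f \o Q) by exact: measurable_within_comp cf _ _.
have mfv k : measurable_fun setT (f \o v (S k)) by exact: measurable_within_comp cf _ _.
have eqk k : (((S k)%:R^-1 * \sum_i f (x (S k) i))%:E =
    \int[mu]_(t in `[0%R, 1%R]) (f (v (S k) t))%:E)%E.
  rewrite -integral_quantile//; last by have := mfv k; rewrite /v ltn0Sn.
under eq_cvg do rewrite eqk.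
have [] := @dominated_convergence _ _ _ mu `[0, 1] (measurable_itv _)
  (fun k t => (f (v (S k) t))%:E) (fun t => (f (Q t))%:E) (cst B%:E) => //.
- by move=> k; apply: measurable_funTS; apply/measurable_EFinP; exact: mfv.
- by apply: measurable_funTS; apply/measurable_EFinP; exact: mfQ.
- exists (Bad `|` [set 0; 1]); split.
  + by apply: measurableU => //; apply: measurableU; exact: measurable_set1.
  + rewrite measureU0//; first by apply: measurableU; exact: measurable_set1.
    by apply: countable_lebesgue_measure0; exact: finite_set_countable.
  + move=> t /= /not_implyP[]; rewrite in_itv/= => /andP[t0 t1] nc.
    have [t00|t00] := eqVneq t 0; first by right; left.
    have [t11|t11] := eqVneq t 1; first by right; right.
    left; apply: contrapT => nb; apply: nc.
    have Et : E t by rewrite EE; split => //=; rewrite in_itv/= !lt_neqAle eq_sym t00 t0 t11 t1.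
    have vQ : v (S k) t @[k --> \oo] --> within D (nbhs (Q t)).
      move=> U hU; have h : \forall k \near \oo, D (v (S k) t) -> U (v (S k) t) := QE t Et _ hU.
      have {}h : \forall k \near \oo, U (v (S k) t) by apply: filterS h => k; apply; exact: vD.
      exact: h.
    have fQ := (subspace_continuousP D f).1 cf (Q t) (QD t).
    apply: cvg_EFin; first exact: nearW.
    exact: (cvg_comp _ _ vQ fQ).
- rewrite (_ : cst B%:E = EFin \o cst B)//; apply: continuous_compact_integrable.
    exact: segment_compact.
  by apply: continuous_subspaceT => t; exact: cvg_cst.
- by apply: aeW => t k _ /=; rewrite lee_fin.
Qed.

End Helly.

(** * Coding by the Cantor set *)

Section CantorCode.
Context {R : realType}.
Implicit Types (b d : cantor_space).

Definition cantor_shift b : cantor_space := fun k => b k.+1.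

Fixpoint code_sum (m : nat) b : R :=
  if m is m'.+1 then ((b 0%N)%:R + code_sum m' (cantor_shift b)) / 3 else 0.

Lemma code_sum_itv m b : 0 <= code_sum m b <= 2^-1.
Proof.
elim: m b => [|m IH] b /=; first by rewrite lexx/= invr_ge0.
have /andP[h1 h2] := IH (cantor_shift b).
have : (b 0%N)%:R <= (1 : R) by case: (b 0%N).
by have : 0 <= (b 0%N)%:R :> R by []; move=> *; apply/andP; split; lra.
Qed.

Lemma code_sum_homo b : nondecreasing_seq (code_sum^~ b).
Proof.
apply/nondecreasing_seqP => m; elim: m b => [|m IH] b.
  by have /andP[] := code_sum_itv 1 b.
by rewrite [leLHS]/= [leRHS]/= ler_pM2r// lerD2l; exact: IH.
Qed.

(** The point of the middle-thirds set with ternary digits [2 * b k],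
    halved. *)
Definition code b : R := limn (code_sum^~ b).

Lemma code_cvg b : code_sum m b @[m --> \oo] --> code b.
Proof.
apply: nondecreasing_is_cvgn; first exact: code_sum_homo.
by exists 2^-1 => _ [m _ <-]; case/andP: (code_sum_itv m b).
Qed.

Lemma code_itv b : 0 <= code b <= 2^-1.
Proof.
apply/andP; split.
  by apply: limr_ge; [exact: code_cvg | apply: nearW => m; case/andP: (code_sum_itv m b)].
by apply: limr_le; [exact: code_cvg | apply: nearW => m; case/andP: (code_sum_itv m b)].
Qed.

Lemma codeS b : code b = ((b 0%N)%:R + code (cantor_shift b)) / 3.
Proof.
have h1 : code_sum m.+1 b @[m --> \oo] --> code b.
  by have := @code_cvg b; rewrite -cvg_shiftS.
have h2 : code_sum m.+1 b @[m --> \oo] --> ((b 0%N)%:R + code (cantor_shift b)) / 3.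
  rewrite /=; apply: cvgM; last exact: cvg_cst.
  apply: cvgD; [exact: cvg_cst | exact: code_cvg].
exact: (cvg_unique (@Rhausdorff R) h1 h2).
Qed.

Lemma code_close m b d : (forall k, (k < m)%N -> b k = d k) ->
  `|code b - code d| <= 2^-1 / 3 ^+ m.
Proof.
elim: m b d => [|m IH] b d bd.
  have /andP[h1 h2] := code_itv b; have /andP[h3 h4] := code_itv d.
  by rewrite expr0 divr1 ler_norml; apply/andP; split; lra.
have -> : code b - code d = (code (cantor_shift b) - code (cantor_shift d)) / 3.
  by rewrite (codeS b) (codeS d) bd//; ring.
rewrite normrM (ger0_norm (x := 3^-1)) ?invr_ge0// exprSr invfM mulrA ler_pM2r ?invr_gt0//.
by apply: IH => k km; apply: bd.
Qed.

Lemma code_far m b d : (forall k, (k < m)%N -> b k = d k) -> b m != d m ->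
  6^-1 / 3 ^+ m <= `|code b - code d|.
Proof.
elim: m b d => [|m IH] b d bd bdm.
  rewrite expr0 divr1 (codeS b) (codeS d).
  have /andP[h1 h2] := code_itv (cantor_shift b); have /andP[h3 h4] := code_itv (cantor_shift d).
  have [->|->] : (b 0%N)%:R = (d 0%N)%:R + 1 :> R \/ (d 0%N)%:R = (b 0%N)%:R + 1 :> R.
    by move: bdm; case: (b 0%N); case: (d 0%N) => // _; [left|right]; rewrite add0r.
    by rewrite ler_normr; apply/orP; left; lra.
  by rewrite ler_normr; apply/orP; right; lra.
have -> : code b - code d = (code (cantor_shift b) - code (cantor_shift d)) / 3.
  by rewrite (codeS b) (codeS d) bd//; ring.
rewrite normrM (ger0_norm (x := 3^-1)) ?invr_ge0// exprSr invfM mulrA ler_pM2r ?invr_gt0//.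
by apply: IH => // k km; apply: bd.
Qed.

(** The distance of two codes is comparable to [3 ^- k], for [k] the first place
    where they differ. *)
Lemma code_sep m b d : `|code b - code d| < 6^-1 / 3 ^+ m ->
  forall k, (k <= m)%N -> b k = d k.
Proof.
move=> bd k km; apply/eqP; apply: contraTT bd => nk; rewrite -leNgt.
have ex : exists k, b k != d k by exists k.
pose k0 := ex_minn ex; have [k0P k0min] : b k0 != d k0 /\ forall j, b j != d j -> (k0 <= j)%N.
  by rewrite /k0; case: ex_minnP.
apply: le_trans (code_far (m := k0) _ k0P); last first.
  move=> j jk; apply/eqP; apply: contraTT jk => /k0min; by rewrite -leqNgt.
rewrite ler_pM2l ?invr_gt0// lef_pV2 ?posrE ?exprn_gt0// ler_eXn2l ?ltr1n//.
by apply: leq_trans km; exact: k0min.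
Qed.

Lemma cantor_near m b : \forall d \near b, forall k, (k < m)%N -> b k = d k.
Proof.
elim: m => [|m IH]; first by apply: (filterS (F := nbhs b) _ (@filterT _ (nbhs b) _)) => d _ k.
have pm : {for b, continuous (fun d : cantor_space => d m)}.
  exact: (@proj_continuous _ (fun=> bool) m).
have hm : \forall d \near b, d m = b m.
  apply: (pm [set x | x = b m]); exact: discrete_set1.
apply: filterS2 IH hm => d IH dm k; rewrite ltnS leq_eqVlt => /predU1P[->//|].
exact: IH.
Qed.

(** Cylinders form a basis of the topology of the Cantor space. *)
Lemma cantor_cylinder b (U : set cantor_space) : nbhs b U ->
  exists m, forall d, (forall k, (k < m)%N -> b k = d k) -> U d.
Proof.
move=> bU; apply: contrapT => /forallNP nU.
have /choice[d dP] : forall m, exists d, (forall k, (k < m)%N -> b k = d k) /\ ~ U d.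
  by move=> m; apply: contrapT => /forallNP nd; apply: (nU m) => d bd; apply: contrapT => Ud; apply: (nd d).
have db : d @ \oo --> b.
  apply/(@pointwise_cvgP nat bool (d @ \oo) b) => k.
  apply: cvg_near_cst; exists k.+1 => // m /= km.
  by rewrite -(dP m).1.
have [m _ mU] := db U bU.
by have := (dP m).2; apply; apply: (mU m) => /=.
Qed.

Lemma code_continuous : continuous code.
Proof.
move=> b; apply/cvgrPdist_lt => e e0.
have [m _ mP] := near_infty_natSinv_lt (PosNum e0).
apply: filterS (cantor_near m.+1 b) => d /code_close h; apply: le_lt_trans h _.
apply: lt_trans (mP m (leqnn m)) => /=.
apply: (@le_lt_trans _ _ ((3 ^+ m.+1)^-1)).
  by rewrite ler_piMl// ?invr_ge0 ?exprn_ge0// invf_le1// ler1n.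
rewrite ltf_pV2 ?posrE ?exprn_gt0// -natrX ltr_nat.
exact: ltn_expl.
Qed.

End CantorCode.

Section CantorImages.
Context {R : realType}.

Definition cantor_image (Y : topologicalType) (K : set Y) : Prop :=
  exists2 F : cantor_space -> Y, continuous F & K `<=` range F.

Lemma set_type_compact (V : topologicalType) (A : set V) : compact A -> compact [set: A].
Proof.
move=> cA F PF _.
have [|a [Aa aF]] := cA (set_val @ F) _.
  have FA : F [set x | A (set_val x)].
    by apply: filterS (@filterT _ F _) => -[x xA] _; exact: (set_mem xA).
  exact: FA.
exists (SigSub (mem_set Aa)); split => // U W FU [W' [[W1 oW1 <-] W1a W1W]].
have aW : nbhs a W1 by apply: open_nbhs_nbhs; split.
have FU' : (set_val @ F) (set_val @` U) by apply: (@filterS _ F _ U) => // u Uu; exists u.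
have [v [[u Uu <-] W1u]] := aF _ _ FU' aW.
by exists u; split => //; apply: W1W.
Qed.

Lemma set_type_hausdorff (V : topologicalType) (A : set V) : hausdorff_space V -> hausdorff_space A.
Proof.
move=> hV x y xy; apply: val_inj; apply: hV => U W xU yW.
have [u [Uu Wu]] := xy (set_val @^-1` U) (set_val @^-1` W)
  (@initial_continuous A V set_val x U xU) (@initial_continuous A V set_val y W yW).
by exists (val u).
Qed.

(** By the Alexandroff-Hausdorff theorem, a nonempty compact subset of a metric
    space is itself a continuous image of the Cantor space. *)
Lemma compact_cantor_image (V : pseudoMetricType R) (Y : ptopologicalType) (A : set V) (f : V -> Y) :
  hausdorff_space V -> compact A -> {within A, continuous f} -> cantor_image (f @` A).
Proof.
move=> hV cA cf; have [[a Aa]|A0] := pselect (A !=set0); last first.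
  exists (cst point); first by move=> x; exact: cvg_cst.
  by move=> y [a Aa _]; exfalso; apply: A0; exists a.
pose T : pseudoPMetricType R :=
  HB.pack_for (pseudoPMetricType R) (set_type A) (isPointed.Build (set_type A) (SigSub (mem_set Aa))).
have [F cF] := @cantor_surj R T (set_type_compact cA) (set_type_hausdorff hV).
exists (f \o set_val \o (F : cantor_space -> set_type A)).
  move=> b; apply: (@continuous_comp cantor_space (set_type A) Y F (f \o set_val)); first exact: cF.
  by have /subspace_sigL_continuousP := cf; exact.
move=> y [v Av <-]; have [b _ bv] := @surj _ _ _ _ F (SigSub (mem_set Av)) I.
by exists b => //=; rewrite bv.
Qed.

(** The codes of the points of the [j]-th set form a copy of the Cantor set in
    [[j, j + 1]]. The copies are at positive distance from each other, so that
    their union is closed; nearby codes share their first digits, whence the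
    continuity of the decoding [S]. *)
Theorem cantor_coding (Y : topologicalType) (K : nat -> set Y) :
  (forall j, cantor_image (K j)) ->
  exists (D : set R) (S : R -> Y), [/\ closed D, (forall x, D x -> 0 <= x),
    {within D, continuous S} &
    forall j y, K j y -> exists x, [/\ D x, S x = y & x <= j.+1%:R]].
Proof.
move=> /(_ _)/cid2-/all_sig2[F Fc FK].
pose pt (jb : nat * cantor_space) : R := jb.1%:R + code jb.2.
pose D := range pt.
have /choice[dec decP] : forall x : R, exists jb : nat * cantor_space, D x -> pt jb = x.
  move=> x; have [[jb _ jbx]|nD] := pselect (D x); first by exists jb.
  by exists (0%N, point).
pose S x := F (dec x).1 (dec x).2.
have close jb jb' m : `|pt jb - pt jb'| < 6^-1 / 3 ^+ m ->
    jb.1 = jb'.1 /\ forall k, (k <= m)%N -> jb.2 k = jb'.2 k.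
  case: jb jb' => [j b] [j' b']; rewrite /pt/= => h.
  have h6 : 6^-1 / 3 ^+ m <= 6^-1 :> R by rewrite ler_piMr// invf_le1 ?exprn_gt0// exprn_ege1// ler1n.
  have /andP[b1 b2] := @code_itv R b; have /andP[b1' b2'] := @code_itv R b'.
  have h1 : `|j%:R - j'%:R| < 1 :> R.
    have := lt_le_trans h h6; rewrite !ltr_norml => /andP[l1 l2]; apply/andP; split; lra.
  have jj : j = j'.
    have [jj|jj|//] := ltngtP j j'; exfalso; move: h1; rewrite ltr_norml => /andP[l1 l2].
      by move: jj; rewrite -(ler_nat R) -natr1; lra.
    by move: jj; rewrite -(ler_nat R) -natr1; lra.
  split => //; apply: (@code_sep R); move: h; rewrite jj.
  by rewrite opprD addrACA subrr add0r.
exists D, S; split.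
- move=> x Dx; pose m := (Num.truncn `|x|).+2.
  pose Km : set R := \bigcup_(j in `I_m) ((fun b => j%:R + code b) @` [set: cantor_space]).
  have cKm : closed Km.
    apply: compact_closed; first exact: Rhausdorff.
    rewrite /Km bigcup_mkord; apply: bigsetU_compact => j _; apply: continuous_compact; last exact: cantor_space_compact.
    apply: continuous_subspaceT => b; apply: cvgD; [exact: cvg_cst | exact: code_continuous].
  have KmD : Km `<=` D.
    by move=> y [j _ [b _ <-]]; exists (j, b).
  apply: KmD; apply: cKm => U xU.
  have xm : \forall y \near x, y < m%:R - 1.
    apply: (cvgr_lt x cvg_id); rewrite /m -natr1 addrK.
    apply: le_lt_trans (ler_norm x) _.
    by have /andP[] := truncn_itv (normr_ge0 x).
  have [y [[[j b] _ <-] [Uy ym]]] := Dx _ (filterI xU xm).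
  exists (pt (j, b)); split => //; exists j; last by exists b.
  have /andP[b1 _] := @code_itv R b.
  rewrite /= -(ltr_nat R); apply: le_lt_trans (_ : pt (j, b) < _); first by rewrite /pt/= lerDl.
  by apply: lt_le_trans ym _; rewrite lerBlDr lerDl.
- move=> x [[j b] _ <-]; have /andP[b1 _] := @code_itv R b.
  by rewrite /pt/= addr_ge0.
- apply/subspace_continuousP => x Dx U xU.
  have [m mU] := cantor_cylinder (Fc (dec x).1 (dec x).2 U xU).
  have e0 : 0 < 6^-1 / 3 ^+ m :> R by rewrite divr_gt0// ?invr_gt0// exprn_gt0.
  have hx := @nbhsx_ballx _ _ x _ e0.
  apply: filterS hx => y; rewrite -ball_normE/= => xy Dy.
  have [E1 E2] : (dec x).1 = (dec y).1 /\ forall k, (k <= m)%N -> (dec x).2 k = (dec y).2 k.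
    by apply: close; rewrite !decP.
  by change (U (S y)); rewrite /S -E1; apply: mU => k /ltnW; exact: E2.
- move=> j y /(FK j)[b _ <-]; exists (pt (j, b)).
  have Dpt : D (pt (j, b)) by exists (j, b).
  have ptE : dec (pt (j, b)) = (j, b).
    have E m : (dec (pt (j, b))).1 = j /\ forall k, (k <= m)%N -> (dec (pt (j, b))).2 k = b k.
      apply: (close (dec (pt (j, b))) (j, b) m).
      by rewrite decP// subrr normr0 divr_gt0// ?invr_gt0// exprn_gt0.
    rewrite (surjective_pairing (dec _)) (E 0%N).1; congr (_, _).
    by apply/funext => k; exact: (E k).2.
  split => //; first by rewrite /S ptE.
  have /andP[_ b2] := @code_itv R b.
  by rewrite /pt/= -natr1 lerD2l (le_trans b2)// invf_le1// ler1n.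
Qed.

End CantorImages.

(** * The space of curves and the flow map *)

Section Curves.
Context {R : realType} {n : nat} {M : riemannian R n}.
Variables (a b : R).

Lemma curve_eval_continuous t : a <= t <= b -> continuous (fun g : curve M a b => g t).
Proof.
move=> tab; apply/continuousP => U oU; rewrite curve_openE => g Ug.
have [e e0 eU] := geodist_nbhs (open_nbhs_nbhs (conj oU Ug)).
exists e => // h gh; apply: eU; apply: le_lt_trans gh.
by apply: ereal_sup_ubound; exists t => //=; rewrite in_itv.
Qed.

Lemma curve_eq (g h : curve M a b) : (forall t, a <= t <= b -> g t = h t) -> a <= b -> g = h.
Proof.
case: g h => [g cg kg] [h ch kh] /= gh ab.
have E : g = h by apply/funext => t; rewrite kg kh; apply: gh; exact: clamp_itv.
by case: _ / E in ch kh *; congr Curve; exact: Prop_irrelevance.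
Qed.

Lemma curve_hausdorff : a <= b -> hausdorff_space (curve M a b).
Proof.
move=> ab g h gh; apply: curve_eq => // t tab.
apply: (@mpoint_hausdorff _ _ M) => U V gU hV.
have [k [Uk Vk]] := gh _ _ (curve_eval_continuous tab gU) (curve_eval_continuous tab hV).
by exists (k t).
Qed.

Variables (L : tangent M -> R) (phi : R -> tangent M -> tangent M).
Hypothesis phiP : euler_lagrange_flow L phi.

Lemma flow_continuous1 s : continuous (phi s).
Proof.
move=> z; apply: (@continuous_comp _ _ _ (fun z : tangent M => (s, z)) (fun q => phi q.1 q.2)).
  have c1 : s @[z0 --> z] --> s by apply: (@cvg_cst R s (tangent M) (nbhs z)).
  have c2 : z0 @[z0 --> z] --> z by exact: cvg_id.
  exact: (cvg_pair c1 c2).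
exact: (flow_continuous phiP).
Qed.

Lemma flow_continuous2 z : continuous (phi^~ z).
Proof.
move=> s; apply: (@continuous_comp _ _ _ (fun s : R => (s, z)) (fun q => phi q.1 q.2)).
  exact: (cvg_pair cvg_id (cvg_cst z)).
exact: (flow_continuous phiP).
Qed.

Lemma flow_fun_joint : continuous (fun q : R * tangent M => flow_fun phi a b q.2 q.1).
Proof.
move=> q; apply: (@continuous_comp _ _ _ (fun q : R * tangent M => phi (clamp a b q.1 - a) q.2)
  (fun y : tangent M => y.1)); last exact: tangent_base_continuous.
apply: (@continuous_comp _ _ _ (fun q : R * tangent M => (clamp a b q.1 - a, q.2))
  (fun q => phi q.1 q.2)); last exact: (flow_continuous phiP).
have c1 : clamp a b q0.1 - a @[q0 --> q] --> clamp a b q.1 - a.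
  apply: cvgB; last exact: cvg_cst.
  by apply: (@continuous_comp _ _ _ fst (clamp a b)); [exact: cvg_fst | exact: clamp_continuous].
have c2 : q0.2 @[q0 --> q] --> q.2 by exact: cvg_snd.
exact: (cvg_pair c1 c2).
Qed.

(** Continuity of a flow is joint in time and initial data, hence uniform over
    the compact time interval. *)
Lemma flow_map_continuous : continuous (flow_map phiP a b : tangent M -> curve M a b).
Proof.
move=> z U; rewrite nbhsE => -[W [oW Wz] WU].
have [e e0 eW] := oW _ Wz; have e20 : 0 < e / 2 by rewrite divr_gt0.
have /compact_near_coveringP cov := @segment_compact R a b.
have : \forall z' \near z, `[a, b] `<=`
    (fun t => (geodist (flow_fun phi a b z t) (flow_fun phi a b z' t) < (e / 2)%:E)%E).
  apply: (cov (tangent M) (nbhs z) (fun z' t =>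
    (geodist (flow_fun phi a b z t) (flow_fun phi a b z' t) < (e / 2)%:E)%E) _) => t _.
  have [V tV VP] := geodist_near2 (flow_fun phi a b z t) e20.
  have h1 : \forall q \near ((t, z) : R * tangent M), V (flow_fun phi a b q.2 q.1).
    exact: (@flow_fun_joint (t, z) V tV).
  have h2 : \forall s \near t, V (flow_fun phi a b z s).
    exact: (@flow_fun_continuous _ _ _ _ _ phiP a b z t V tV).
  have h3 : \forall q \near ((t, z) : R * tangent M), V (flow_fun phi a b z q.1).
    exact: (cvg_fst h2).
  by apply: filterS2 h1 h3 => q h1 h3; exact: VP.
apply: filterS => z' zz'; apply: WU; apply: eW; apply: (@le_lt_trans _ _ (e / 2)%:E).
  by apply: ge_ereal_sup => _ [t tab <-]; apply: ltW; exact: zz'.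
by rewrite lte_fin ltr_pdivrMr// ltr_pMr// ltr1n.
Qed.

Hypothesis ltab : a < b.

Lemma flow_map_a z : flow_map phiP a b z a = z.1.
Proof. by rewrite /= /flow_fun clamp_id ?lexx ?ltW// subrr (flow0 phiP). Qed.

Lemma flow_map_b z : flow_map phiP a b z b = (phi (b - a) z).1.
Proof. by rewrite /= /flow_fun clamp_id ?lexx ?ltW. Qed.

Lemma flow_shift z t : phi (t - a) z = phi t (phi (- a) z).
Proof. by rewrite -(flowD phiP). Qed.

Lemma flow_map_extremal z : extremal L (flow_map phiP a b z).
Proof.
exists (fun t => (phi t (phi (- a) z)).1); first exact: (flow_solves phiP).
by move=> t tab; rewrite /= /flow_fun clamp_id// flow_shift.
Qed.

Lemma extremal_flow_map (g : curve M a b) : extremal L g -> exists z, g = flow_map phiP a b z.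
Proof.
move=> [h hs gh]; exists (velocity h a); apply: curve_eq; last exact: ltW.
move=> t tab; rewrite gh//= /flow_fun clamp_id//.
by rewrite -(flow_unique phiP hs (s := a) (t := t))// lexx ltW.
Qed.

(** An extremal is determined by its velocity at time [a]. *)
Lemma extremals_between_flow (Ka Kb : set M) : extremals_between L Ka Kb =
  flow_map phiP a b @` [set z : tangent M | Ka z.1 /\ Kb (phi (b - a) z).1].
Proof.
apply/seteqP; split => [g [/extremal_flow_map[z ->]]|_ [z [Kz Kz'] <-]].
  by rewrite flow_map_a flow_map_b => Kz Kz'; exists z.
by split; [exact: flow_map_extremal | rewrite flow_map_a | rewrite flow_map_b].
Qed.

End Curves.

(** * Coding the initial velocities of short curves *)

Section CantorUnion.
Context {R : realType} {Y : ptopologicalType}.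

Lemma cantor_image0 : cantor_image (set0 : set Y).
Proof. by exists (cst point) => //; move=> x; exact: cvg_cst. Qed.

Lemma cantor_image_sub (A B : set Y) : A `<=` B -> cantor_image B -> cantor_image A.
Proof. by move=> AB [F cF BF]; exists F => //; exact: subset_trans BF. Qed.

(** The first digit selects the map. *)
Lemma cantor_imageU (A B : set Y) :
  cantor_image A -> cantor_image B -> cantor_image (A `|` B).
Proof.
move=> [FA cA AF] [FB cB BF].
exists (fun d => if d 0%N then FA (cantor_shift d) else FB (cantor_shift d)); last first.
  move=> y [/AF[d _ <-]|/BF[d _ <-]].
    by exists (fun k => if k is k'.+1 then d k' else true).
  by exists (fun k => if k is k'.+1 then d k' else false).
have step (F : cantor_space -> Y) (G : cantor_space -> Y) d : {for cantor_shift d, continuous F} ->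
    (forall d', d 0%N = d' 0%N -> G d' = F (cantor_shift d')) -> {for d, continuous G}.
  move=> cF GF U; rewrite GF// => /cF/cantor_cylinder[m mU].
  apply: filterS (cantor_near m.+1 d) => d' dd'.
  change (U (G d')); rewrite GF; last exact: dd'.
  by apply: mU => k km; apply: (dd' k.+1).
move=> d; case E : (d 0%N).
  by apply: (step FA); [exact: cA | move=> d' <-; rewrite E].
by apply: (step FB); [exact: cB | move=> d' <-; rewrite E].
Qed.

End CantorUnion.

Lemma hausdorff_prod (T U : topologicalType) :
  hausdorff_space T -> hausdorff_space U -> hausdorff_space (T * U)%type.
Proof.
move=> hT hU [x1 x2] [y1 y2] xy; congr (_, _).
  apply: hT => A B xA yB.
  have [z [Az Bz]] := xy (fst @^-1` A) (fst @^-1` B) (cvg_fst xA) (cvg_fst yB).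
  by exists z.1.
apply: hU => A B xA yB.
have [z [Az Bz]] := xy (snd @^-1` A) (snd @^-1` B) (cvg_snd xA) (cvg_snd yB).
by exists z.2.
Qed.

Section Cells.
Context {R : realType} {n : nat} {M : riemannian R n}.
Variables (L : tangent M -> R) (phi : R -> tangent M -> tangent M).
Hypothesis phiP : euler_lagrange_flow L phi.

(** With [s = a - t], these are the velocities at time [a] of the orbits that at
    some time [t] are over [A] and have speed at most [rho]. *)
Definition flow_cell (A : set M) (c d rho : R) : set (tangent M) :=
  [set z | exists s y, [/\ c <= s <= d, A y.1, tnorm y <= rho & z = phi s y]].

(** In a chart, bounded sets of tangent vectors lie in products of balls of
    [R^n], so that Alexandroff-Hausdorff is only applied to metric spaces. *)
Lemma flow_cell_chart (x : M) (c d rho : R) :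
  exists2 U : set M, nbhs x U & cantor_image (flow_cell U c d rho).
Proof.
have [k [r [l [B [xk [r0 l0 _] rk lB]]]]] := chart_ball (@filterT _ (nbhs x) _).
exists [set y | dom k y /\ `|coord k y - coord k x| <= r].
  apply: filterI; first by apply: open_nbhs_nbhs; split => //; exact: dom_open.
  have cx : `|coord k y - coord k x| @[y --> x] --> (0 : R).
    have -> : 0 = `|coord k x - coord k x| by rewrite subrr normr0.
    exact: coord_norm_continuous.
  by apply: filterS (cvgr_lt _ cx r r0) => y /ltW.
pose W : set (R * ('rV[R]_n * 'rV[R]_n)) :=
  `[c, d] `*` ([set p | `|p - coord k x| <= r] `*` [set w | `|w - 0| <= rho / l]).
have cW : compact W.
  by apply: compact_setX; [exact: segment_compact | apply: compact_setX; exact: rV_ball_compact].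
apply: (@cantor_image_sub _ _ ((fun q => phi q.1 (tinv k q.2)) @` W)); last first.
  have hV : hausdorff_space (R * ('rV[R]_n * 'rV[R]_n))%type.
    by apply: hausdorff_prod; [exact: Rhausdorff | apply: hausdorff_prod; exact: norm_hausdorff].
  apply: (compact_cantor_image hV cW).
  apply/continuous_in_subspaceT => q; rewrite inE => -[_ [/rk[q1 _] _]].
  apply: (@continuous_comp _ _ _ (fun q : R * ('rV[R]_n * 'rV[R]_n) => (q.1, tinv k q.2))
    (fun q => phi q.1 q.2)); last exact: (flow_continuous phiP).
  have c1 : q'.1 @[q' --> q] --> q.1 by exact: cvg_fst.
  have c2 : tinv k q'.2 @[q' --> q] --> tinv k q.2.
    by apply: (@continuous_comp _ _ _ snd (tinv k)); [exact: cvg_snd | exact: tinv_continuous].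
  exact: (cvg_pair c1 c2).
move=> _ [s [y [sP [ky yr] yrho ->]]].
exists (s, tcoord k y); last by rewrite /= tcoordK.
split; first by rewrite /= in_itv.
split => //=; rewrite subr0 ler_pdivlMr// mulrC.
have := lB (coord k y.1) (tcoord k y).2 yr.
by rewrite -[X in tinv k X]/(tcoord k y) tcoordK// => /andP[+ _] => /le_trans; apply.
Qed.

Lemma flow_cell_cantor A c d rho : compact A -> cantor_image (flow_cell A c d rho).
Proof.
move=> cA; apply: (@compact_union_ind _ (fun A => cantor_image (flow_cell A c d rho))) cA.
- by apply: cantor_image_sub cantor_image0 => z [s [y []]].
- move=> A1 A2 h1 h2; apply: cantor_image_sub (cantor_imageU h1 h2).
  by move=> z [s [y [? [Ay|Ay] ? ->]]]; [left|right]; exists s, y.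
- move=> A1 A2 A12; apply: cantor_image_sub => z [s [y [? Ay ? ->]]].
  by exists s, y; split => //; exact: A12.
- by move=> x _; exact: flow_cell_chart.
Qed.

End Cells.

(** * Action, length and tightness *)

Section Action.
Context {R : realType} {n : nat} {M : riemannian R n}.
Local Notation mu := (@lebesgue_measure R).

Lemma lagrangian_continuous (L : tangent M -> R) : lagrangian_smooth L -> continuous L.
Proof.
move=> Ls; apply: continuous_tangent => c q cq.
exact: smooth_on_continuous (Ls c) cq.
Qed.

Lemma near_eq_velocity (g h : R -> M) t :
  (\near t, g t = h t) -> velocity g t = velocity h t.
Proof.
move=> gh; rewrite /velocity (nbhs_singleton gh); congr (_, _).
by apply: near_eq_derive; apply: filterS gh => s /= ->.
Qed.

Variables (L : tangent M -> R) (phi : R -> tangent M -> tangent M).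
Hypothesis phiP : euler_lagrange_flow L phi.
Variables (a b : R).
Hypothesis ltab : a < b.

Definition flow_length (z : tangent M) : R :=
  fine (\int[mu]_(t in `[a, b]) (tnorm (phi (t - a) z))%:E).

Lemma flow_speed_continuous z : continuous (fun t : R => tnorm (phi (t - a) z)).
Proof.
move=> t; apply: (@continuous_comp _ _ _ (fun t : R => phi (t - a) z) (@tnorm R n M)).
  apply: (@continuous_comp _ _ _ (fun t : R => t - a) (phi^~ z)).
    by apply: cvgB; [exact: cvg_id | exact: cvg_cst].
  exact: (flow_continuous2 phiP).
exact: tnorm_continuous.
Qed.

Lemma flow_orbit_velocity z t :
  velocity (fun t => (phi (t - a) z).1) t = phi (t - a) z.
Proof.
have -> : (fun t => (phi (t - a) z).1) = (fun t => (phi t (phi (- a) z)).1).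
  by apply/funext => s; rewrite -(flowD phiP).
by rewrite (flow_velocity phiP) -(flowD phiP).
Qed.

Lemma flow_speed_primitive z : exists F : R -> R,
  (forall t, a <= t -> is_derive t (1 : R) F (tnorm (phi (t - a) z))) /\
  forall u v, a <= u -> u <= v ->
    (\int[mu]_(t in `[u, v]) (tnorm (phi (t - a) z))%:E = (F v - F u)%:E)%E.
Proof.
have cs := @flow_speed_continuous z.
have [F dF] := primitive_exists (a - 1) cs.
have dF' t : a <= t -> is_derive t (1 : R) F (tnorm (phi (t - a) z)).
  by move=> at_; apply: dF; rewrite (lt_le_trans _ at_)// ltrBlDr ltrDl.
exists F; split => // u v au uv; apply: integral_primitive => // t /andP[ut _].
by apply: dF'; exact: le_trans ut.
Qed.

(** The last clause is the mean value theorem for a primitive of the speed. *)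
Lemma flow_lengthP z : [/\ 0 <= flow_length z,
  (\int[mu]_(t in `[a, b]) (tnorm (phi (t - a) z))%:E = (flow_length z)%:E)%E,
  forall t, a <= t <= b -> (geodist z.1 (phi (t - a) z).1 <= (flow_length z)%:E)%E &
  exists2 t, a <= t <= b & tnorm (phi (t - a) z) * (b - a) = flow_length z].
Proof.
have [F [dF' intF]] := flow_speed_primitive z.
have lE : flow_length z = F b - F a by rewrite /flow_length intF// ltW.
have Fle u v : a <= u -> u <= v -> F u <= F v.
  move=> au uv; rewrite -subr_ge0 -lee_fin -intF//.
  by apply: integral_ge0 => t _; rewrite lee_fin tnorm_ge0.
split; rewrite ?lE ?intF ?lexx ?(ltW ltab)//.
- by rewrite subr_ge0 Fle ?lexx// ltW.
- move=> t /andP[at_ tb]; pose h s := (phi (s - a) z).1.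
  have : solves_euler_lagrange L a b h.
    have := flow_solves phiP (phi (- a) z) a b.
    by congr solves_euler_lagrange; apply/funext => s; rewrite /h -(flowD phiP).
  move=> [[J [oJ abJ] hJ] _].
  have ha : h a = z.1 by rewrite /h subrr (flow0 phiP).
  have := @pw_path_curve _ _ _ J h a b a t oJ hJ.
  rewrite lexx ltW// at_ tb => /(_ isT isT abJ)/geodist_le.
  rewrite ha => /le_trans; apply.
  rewrite (min_l at_) (max_r at_).
  under eq_integral do rewrite flow_orbit_velocity.
  by rewrite intF// lee_fin lerD2r Fle.
- have cF : {within `[a, b], continuous F}.
    apply: derivable_within_continuous => t; rewrite in_itv/= => /andP[at_ _].
    by have [] := dF' t at_.
  have dFo t : t \in `]a, b[ -> is_derive t (1 : R) F (tnorm (phi (t - a) z)).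
    by rewrite in_itv/= => /andP[/ltW at_ _]; exact: dF'.
  have [t tab ->] := MVT_segment (ltW ltab) dFo cF.
  by exists t => //; move: tab; rewrite in_itv.
Qed.

Lemma flow_map_velocity z t : a < t < b ->
  velocity (flow_map phiP a b z) t = phi (t - a) z.
Proof.
move=> /andP[at_ tb]; rewrite -flow_orbit_velocity; apply: near_eq_velocity.
have h1 : \forall s \near t, a < s by exact: lt_nbhsr.
have h2 : \forall s \near t, s < b by exact: lt_nbhsl.
apply: filterS2 h1 h2 => s as_ sb.
by rewrite /= /flow_fun clamp_id// !ltW.
Qed.

(** Curves are constant outside [[a, b]], so that their velocity agrees with the
    flow only in the open interval. *)
Lemma action_flow_length (c1 c2 : R) z : lagrangian_smooth L ->
  (forall z, c1 * tnorm z - c2 <= L z) ->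
  ((c1 * flow_length z - c2 * (b - a))%:E <= action L (flow_map phiP a b z))%E.
Proof.
move=> Ls Lg; rewrite /action; case: asboolP => _; last by rewrite leey.
have cL : continuous (fun t : R => L (phi (t - a) z)).
  move=> t; apply: (@continuous_comp _ _ _ (fun t : R => phi (t - a) z) L).
    apply: (@continuous_comp _ _ _ (fun t : R => t - a) (phi^~ z)).
      by apply: cvgB; [exact: cvg_id | exact: cvg_cst].
    exact: (flow_continuous2 phiP).
  exact: lagrangian_continuous.
have mcont (f : R -> R) D : measurable D -> continuous f -> measurable_fun D f.
  by move=> mD cf; apply: measurable_funTS; exact: continuous_measurable_fun.
have E : {in `]a, b[, (fun t => L (velocity (flow_map phiP a b z) t)) =1
    fun t => L (phi (t - a) z)}.
  by move=> t; rewrite in_itv/= => tab; rewrite flow_map_velocity.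
rewrite (@eq_integral_itv_bounded _ a b (fun t => L (phi (t - a) z))
  (fun t => L (velocity (flow_map phiP a b z) t)) true false) //; last 2 first.
- apply: (@eq_measurable_fun _ _ _ _ `]a, b[%classic (fun t => L (phi (t - a) z))).
    by move=> t; rewrite inE/= => tab; rewrite E.
  exact: mcont.
- exact: mcont.
have cs := @flow_speed_continuous z.
have c3 : continuous (fun t : R => c1 * tnorm (phi (t - a) z) - c2).
  by move=> t; apply: cvgB; [apply: cvgMr; exact: cs | exact: cvg_cst].
have [F [dF' intF]] := flow_speed_primitive z.
have lE : flow_length z = F b - F a.
  by rewrite /flow_length intF// ltW.
have -> : (c1 * flow_length z - c2 * (b - a))%:E =
    (\int[mu]_(t in `[a, b]) (c1 * tnorm (phi (t - a) z) - c2)%:E)%E.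
  have dG t : a <= t <= b -> is_derive t (1 : R) (fun t => c1 * F t - c2 * t)
      (c1 * tnorm (phi (t - a) z) - c2).
    move=> /andP[at_ _]; have dFt := dF' t at_.
    have := is_deriveB (is_deriveZ c1 dFt) (is_deriveZ c2 (is_derive_id t (1 : R))).
    by rewrite /GRing.scale/= mulr1.
  by rewrite (integral_primitive (ltW ltab) c3 dG) lE; congr (_%:E); ring.
apply: le_integral => //.
- apply: continuous_compact_integrable; first exact: segment_compact.
  exact: within_continuous.
- apply: continuous_compact_integrable; first exact: segment_compact.
  exact: within_continuous.
- by move=> t _; rewrite lee_fin.
Qed.

End Action.

(** * Empirical measures and limits *)

Section Borel.
Context {R : realType}.
Local Notation mu := (@lebesgue_measure R).

Lemma open_borel (T : ptopologicalType) (U : set T) : open U -> measurable (U : set (borel T)).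
Proof. by move=> oU; apply: sub_sigma_algebra. Qed.

Lemma closed_borel (T : ptopologicalType) (U : set T) : closed U -> measurable (U : set (borel T)).
Proof.
by move=> cU; rewrite -[U]setCK; apply: measurableC; apply: open_borel; exact: closed_openC.
Qed.

Lemma borel_measurable_fun d (X : measurableType d) (T : ptopologicalType) (f : X -> borel T) :
  (forall U : set T, open U -> measurable (f @^-1` U)) -> measurable_fun setT f.
Proof.
move=> h; apply: (@measurability _ _ _ _ setT f (@open T)) => //.
by move=> _ [U oU <-]; rewrite setTI; exact: h.
Qed.

Lemma continuous_borel (T T' : ptopologicalType) (f : T -> T') : continuous f ->
  measurable_fun setT (f : borel T -> borel T').
Proof.
move=> cf; apply: borel_measurable_fun => U oU; apply: open_borel.
by apply: open_comp => // x _; exact: cf.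
Qed.

Lemma continuous_borelR (T : ptopologicalType) (f : T -> R) : continuous f ->
  measurable_fun setT (f : borel T -> R).
Proof.
move=> cf; apply: (measurability _ (RGenOpens.measurableE R)).
move=> _ [_ [a [b ->] <-]]; rewrite setTI; apply: open_borel.
by apply: open_comp; [move=> x _; exact: cf | exact: interval_open].
Qed.

Lemma ge0_integral_empirical (T : ptopologicalType) (N : nat) (x : 'I_N -> borel T)
  (f : T -> R) : measurable_fun setT (f : borel T -> R) -> (forall y, 0 <= f y) ->
  (\int[empirical x]_y (f y)%:E = (N%:R^-1 * \sum_i f (x i))%:E)%E.
Proof.
move=> mf f0; pose y k := oapp x point (insub k : option 'I_N).
have N0 : (0 <= N%:R^-1 :> R)%R by [].
have mfE : measurable_fun setT (fun y : borel T => (f y)%:E) by exact/measurable_EFinP.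
transitivity (\int[mscale (NngNum N0) (msum (fun k => dirac (y k)) N)]_y (f y)%:E)%E.
  apply: eq_measure_integral => A _ _; rewrite /empirical /mscale/= /msum.
  by congr (_ * _)%E; apply: eq_bigr => i _; rewrite /y valK.
rewrite ge0_integral_mscale//; last by move=> z _; rewrite lee_fin.
rewrite ge0_integral_measure_sum//; last by move=> z _; rewrite lee_fin.
rewrite EFinM -sumEFin; congr (_ * _)%E; apply: eq_bigr => i _.
by rewrite integral_dirac// diracT mul1e /y valK.
Qed.

(** By splitting [f] into its positive and negative parts. *)
Lemma integral_empirical (T : ptopologicalType) (N : nat) (x : 'I_N -> borel T)
  (f : T -> R) : measurable_fun setT (f : borel T -> R) ->
  (\int[empirical x]_y (f y)%:E = (N%:R^-1 * \sum_i f (x i))%:E)%E.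
Proof.
move=> mf; rewrite integralE.
have -> : (\int[empirical x]_y ((fun y => (f y)%:E)^\+ y) = \int[empirical x]_y (f^\+ y)%:E)%E.
  by apply: eq_integral => y _; rewrite funerpos.
have -> : (\int[empirical x]_y ((fun y => (f y)%:E)^\- y) = \int[empirical x]_y (f^\- y)%:E)%E.
  by apply: eq_integral => y _; rewrite funerneg.
rewrite !ge0_integral_empirical ?funrpos_ge0 ?funrneg_ge0//.
- rewrite -EFinB -mulrBr -sumrB; congr (_ * _)%:E; apply: eq_bigr => i _.
  by rewrite -[in RHS](funrposBneg f).
- exact: measurable_funrneg.
- exact: measurable_funrpos.
Qed.

Lemma integral_distribution_uniform d (T : measurableType d)
  (X : {mfun measurableTypeR R >-> T}) (f : T -> \bar R) : measurable_fun setT f ->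
  (\int[distribution (uniform_prob (@ltr01 R)) X]_y f y = \int[mu]_(t in `[0%R, 1%R]) f (X t))%E.
Proof.
move=> mf.
have ge0 (h : T -> \bar R) : measurable_fun setT h -> (forall y, 0 <= h y)%E ->
    (\int[distribution (uniform_prob (@ltr01 R)) X]_y h y = \int[mu]_(t in `[0%R, 1%R]) h (X t))%E.
  move=> mh h0; rewrite ge0_integral_distribution// integral_uniform//.
  - by rewrite subr0 invr1 mul1e.
  - exact: measurableT_comp.
  - by move=> t; exact: h0.
rewrite integralE [RHS]integralE !ge0//.
- by congr (_ - _)%E; apply: eq_integral => t _; rewrite ?funeposE ?funenegE.
- exact: measurable_funeneg.
- exact: measurable_funepos.
Qed.

Lemma measurable_within_comp_borel (T : ptopologicalType) (D : set R) (S : R -> T) (Q : R -> R) :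
  {within D, continuous S} -> measurable_fun setT Q -> (forall t, D (Q t)) ->
  measurable_fun setT (S \o Q : measurableTypeR R -> borel T).
Proof.
move=> cS mQ DQ; apply: borel_measurable_fun => U oU.
have /continuousP cS' := cS.
have /open_subspaceP[V oV VU] := cS' U oU.
have -> : (S \o Q) @^-1` U = Q @^-1` V.
  apply/seteqP; split => t /= h.
    by have [] : (V `&` D) (Q t) by rewrite VU; split.
  by have [] : (S @^-1` U `&` D) (Q t) by rewrite -VU; split.
rewrite -[X in measurable X]setTI; apply: mQ => //; exact: open_measurable.
Qed.

Lemma markov_count (I : finType) (y : I -> R) (B : R) : (forall i, 0 <= y i) ->
  B * #|[pred i | (B < y i)%R]|%:R <= \sum_i y i.
Proof.
move=> y0; apply: (@le_trans _ _ (\sum_(i | (B < y i)%R) y i)).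
  rewrite mulr_natr -sumr_const; apply: ler_sum => i; rewrite inE; exact: ltW.
by rewrite [leRHS](bigID (fun i => (B < y i)%R))/= lerDl sumr_ge0.
Qed.

End Borel.

Section Tightness.
Context {R : realType} {n : nat} {M : riemannian R n}.
Variables (L : tangent M -> R) (phi : R -> tangent M -> tangent M).
Hypothesis phiP : euler_lagrange_flow L phi.
Variables (a b : R).
Hypothesis ltab : a < b.
Hypothesis Mcomplete : complete_manifold M.
Variable Ka : set M.
Hypothesis Ka_compact : compact Ka.

Local Notation flow_length := (flow_length phi a b).

(** A short curve stays close to [Ka], and its speed is at some time at most
    its average speed. By Hopf-Rinow this confines it to a compact set of tangent
    vectors at that time. *)
Lemma flow_length_cell z (m : R) : Ka z.1 -> flow_length z <= m ->
  flow_cell phi (closed_nbhd Ka m) (a - b) 0 (m / (b - a)) z.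
Proof.
move=> Kz lm; have [_ _ dist [t /andP[at_ tb] tl]] := flow_lengthP phiP ltab z.
exists (- (t - a)), (phi (t - a) z); split.
- by rewrite opprB lerD2l lerN2 tb subr_le0.
- move=> d d0; exists z.1 => //; apply: (@le_lt_trans _ _ (flow_length z)%:E).
    by apply: dist; rewrite at_.
  by rewrite lte_fin (le_lt_trans lm)// ltrDl.
- by rewrite ler_pdivlMr ?subr_gt0// tl.
- by rewrite -(flowD phiP) addNr (flow0 phiP).
Qed.

(** Since codes are controlled by lengths, a bound on the mean length of the
    curves makes the codes of their initial velocities tight. *)
Lemma initial_velocity_coding : exists (D : set R) (S : R -> tangent M),
  [/\ closed D, (forall x, D x -> 0 <= x), {within D, continuous S} &
    forall z, Ka z.1 -> exists x, [/\ D x, S x = z & x <= flow_length z + 2]].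
Proof.
have [j|D [S [cD D0 cS DS]]] := @cantor_coding R (tangent M)
    (fun j => flow_cell phi (closed_nbhd Ka j%:R) (a - b) 0 (j%:R / (b - a))).
  by apply: (flow_cell_cantor phiP); exact: (closed_nbhd_compact Mcomplete Ka_compact).
exists D, S; split => // z Kz; have [l0 _ _ _] := flow_lengthP phiP ltab z.
have /andP[tl lt] := truncn_itv l0.
have [x [Dx Sx xj]] := DS _ z (flow_length_cell Kz (ltW lt)).
exists x; split => //; apply: le_trans xj _.
by rewrite -[X in X%:R]addn2 natrD lerD2r.
Qed.

Lemma sum_flow_length (c1 c2 C : R) N (z : 'I_N -> tangent M) : (0 < N)%N -> 0 < c1 ->
  lagrangian_smooth L -> (forall z, c1 * tnorm z - c2 <= L z) ->
  (mean_action L (fun i => flow_map phiP a b (z i)) <= C%:E)%E ->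
  \sum_i flow_length (z i) <= N%:R * ((C + c2 * (b - a)) / c1).
Proof.
move=> N0 c10 Ls Lg; rewrite /mean_action => hC.
have N0' : 0 < N%:R :> R by rewrite ltr0n.
have : ((N%:R^-1)%:E * (\sum_i (c1 * flow_length (z i) - c2 * (b - a)))%:E <= C%:E)%E.
  apply: le_trans hC; apply: lee_wpmul2l; first by rewrite lee_fin invr_ge0 ltW.
  by rewrite -sumEFin; apply: lee_sum => i _; exact: (action_flow_length phiP ltab).
rewrite -EFinM lee_fin mulrC ler_pdivrMr// big_split/= -mulr_sumr sumr_const card_ord => h.
rewrite mulrA ler_pdivlMr//; move: h; rewrite -mulr_natl; lra.
Qed.

Variables (Kb : set M).
Hypothesis Kb_compact : compact Kb.

Definition boundary_data : set (tangent M) := [set z | Ka z.1 /\ Kb (phi (b - a) z).1].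

Lemma boundary_data_closed : closed boundary_data.
Proof.
have cK (K : set M) : compact K -> closed K by move=> cK; apply: compact_closed => //; exact: mpoint_hausdorff.
have -> : boundary_data = (fun z : tangent M => z.1) @^-1` Ka `&`
    (fun z : tangent M => (phi (b - a) z).1) @^-1` Kb by [].
apply: closedI; apply: closed_preimage; rewrite //; try exact: cK.
  exact: tangent_base_continuous.
move=> z; apply: (@continuous_comp _ _ _ (phi (b - a)) (fun z : tangent M => z.1)).
  exact: (flow_continuous1 phiP).
exact: tangent_base_continuous.
Qed.

(** The boundary data are exhausted by countably many compact sets, whose images
    are compact, hence closed in the Hausdorff space of curves. *)
Lemma extremals_between_borel :
  measurable (extremals_between L Ka Kb : set (borel (curve M a b))).
Proof.
have /choice[F FP] : forall m : nat, exists F : cantor_space -> tangent M,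
    continuous F /\ forall z : tangent M, Ka z.1 -> tnorm z <= m%:R -> range F z.
  move=> m; have [F cF FK] := flow_cell_cantor phiP 0 0 m%:R Ka_compact.
  exists F; split => // z Kz zm; apply: FK; exists 0, z; split => //.
    by rewrite lexx.
  by rewrite (flow0 phiP).
have -> : extremals_between L Ka Kb = \bigcup_m (flow_map phiP a b @` (boundary_data `&` range (F m))).
  rewrite (extremals_between_flow phiP ltab); apply/seteqP; split => [_ [z zP <-]|_ [m _ [z [zP _] <-]]].
    exists (Num.truncn (tnorm z)).+1 => //; exists z => //; split => //.
    apply: (FP _).2; first by case: zP.
    by have /andP[_ /ltW] := truncn_itv (tnorm_ge0 z).
  by exists z.
apply: bigcupT_measurable => m; apply: closed_borel; apply: compact_closed.
  by apply: curve_hausdorff; exact: ltW.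
apply: continuous_compact; first exact/continuous_subspaceT/flow_map_continuous.
rewrite setIC; apply: compact_closedI; last exact: boundary_data_closed.
apply: continuous_compact; last exact: cantor_space_compact.
exact/continuous_subspaceT/(FP m).1.
Qed.

End Tightness.

(** * Compactness of stationary points *)

Theorem theorem3p11 (R : realType) (n : nat) (M : riemannian R n)
  (Mconnected : connected [set: M]) (Mcomplete : complete_manifold M)
  (L : tangent M -> R)
  (Lsmooth : lagrangian_smooth L)
  (Lconvex : lagrangian_convex L)
  (Lgrowth : lagrangian_growth L)
  (phi : R -> tangent M -> tangent M) (phiP : euler_lagrange_flow L phi)
  (a b : R) (ltab : a < b)
  (Ka Kb : set M) (Ka_compact : compact Ka) (Kb_compact : compact Kb)
  (C : R) (g : forall N : nat, 'I_N -> curve M a b)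
  (g_stationary : forall N : nat, (0 < N)%N -> stationary L (g N))
  (g_action : forall N : nat, (0 < N)%N -> (mean_action L (g N) <= C%:E)%E)
  (g_left : forall N : nat, (0 < N)%N -> forall i : 'I_N, Ka (g N i a))
  (g_right : forall N : nat, (0 < N)%N -> forall i : 'I_N, Kb (g N i b)) :
  exists (s : nat -> nat) (pi : probability (borel (curve M a b)) R),
    [/\ {homo s : j k / (j < k)%N},
        weak_cvg (fun k => empirical (g (s k))) pi,
        measurable (extremals_between L Ka Kb : set (borel (curve M a b))) /\
          pi (extremals_between L Ka Kb) = 1%E &
        exists eta : {measure set (borel (tangent M)) -> \bar R},
          forall A : set (borel (curve M a b)), measurable A ->
            pi A = pushforward eta
              (flow_map phiP a b : borel (tangent M) -> borel (curve M a b)) A].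
Proof.
have [c1 [c2 [c10 _ Lg]]] := Lgrowth.
have pos N (i : 'I_N) : (0 < N)%N by exact: leq_ltn_trans (ltn_ord i).
have zex N (i : 'I_N) : exists z, g N i = flow_map phiP a b z.
  by apply: extremal_flow_map => //; exact: g_stationary (pos N i) i.
pose z N i := sval (cid (zex N i)).
have gz N i : g N i = flow_map phiP a b (z N i) by exact: svalP (cid (zex N i)).
have Kz N i : Ka (z N i).1.
  by rewrite -(flow_map_a phiP ltab) -gz; exact: g_left (pos N i) i.
have Zz N i : boundary_data phi a b Ka Kb (z N i).
  by split=> //; rewrite -(flow_map_b phiP ltab) -gz; exact: g_right (pos N i) i.
have [D [S [cD D0 cS DS]]] := initial_velocity_coding phiP ltab Mcomplete Ka_compact.
have /all_sig2[x xP] N : {x : 'I_N -> R | forall i, D (x i) /\ S (x i) = z N i &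
    forall i, x i <= flow_length phi a b (z N i) + 2}.
  have /choice[x xP] : forall i : 'I_N, exists x,
      [/\ D x, S x = z N i & x <= flow_length phi a b (z N i) + 2].
    by move=> i; exact: DS.
  by apply: cid2; exists x => i; have [] := xP i.
move=> xl.
(* Codes are restricted to those of boundary data, a closed condition, so that
   the limit law is carried by extremals between [Ka] and [Kb]. *)
pose Z := boundary_data phi a b Ka Kb.
pose DZ := D `&` S @^-1` Z.
have cDZ : closed DZ.
  have /continuous_closedP/(_ Z (boundary_data_closed phiP Ka_compact Kb_compact)) := cS.
  move=> /closed_subspaceP[V cV VZ].
  by rewrite /DZ setIC -VZ; exact: closedI.
have cSZ : {within DZ, continuous S} by apply: continuous_subspaceW cS => t [].
have xD N i : DZ (x N i) by have [Dx Sx] := xP N i; split => //; rewrite /= Sx; exact: Zz.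
have [|s [Q [sinc mQ DQ Qcvg]]] := helly_selection cDZ (xD 1%N ord0) xD
    (fun N i => D0 _ (xD N i).1) _.
  move=> e e0; pose C' := (C + c2 * (b - a)) / c1.
  (* Codes exceed lengths by at most 2, and the mean length is at most [C']. *)
  exists (Num.max 0 (C' / e) + 1 + 2) => N N0.
  set B := Num.max 0 (C' / e) + 1 + 2.
  have B0 : 0 < B - 2 by rewrite /B addrK ltr_pwDr// le_max lexx.
  have lsum : \sum_i flow_length phi a b (z N i) <= N%:R * C'.
    apply: (sum_flow_length (phiP := phiP) ltab N0 c10 Lsmooth Lg).
    rewrite (_ : (fun i => _) = g N); first exact: g_action.
    by apply/funext => i; rewrite gz.
  have l0 i : 0 <= flow_length phi a b (z N i) by have [] := flow_lengthP phiP ltab (z N i).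
  have h := le_trans (markov_count (B - 2) l0) lsum.
  have cle : (#|[pred i | (B < x N i)%R]| <=
      #|[pred i : 'I_N | (B - 2 < flow_length phi a b (z N i))%R]|)%N.
    apply: subset_leq_card; apply/fintype.subsetP => i; rewrite !inE => Bx.
    by rewrite ltrBlDr; exact: lt_le_trans Bx (xl N i).
  have C'B : C' <= e * (B - 2).
    rewrite mulrC -ler_pdivrMr// /B addrK; apply: (@le_trans _ _ (Num.max 0 (C' / e))).
      by rewrite le_max lexx orbT.
    by rewrite lerDl.
  apply: (@le_trans _ _ #|[pred i : 'I_N | (B - 2 < flow_length phi a b (z N i))%R]|%:R).
    by rewrite ler_nat.
  rewrite -(ler_pM2l B0); apply: le_trans h _.
  rewrite mulrC mulrA ler_wpM2r ?ler0n// (mulrC _ e)//.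
have mG := extremals_between_borel phiP ltab Ka_compact Kb_compact.
pose X0 : measurableTypeR R -> borel (tangent M) := S \o Q.
have mX0 : measurable_fun setT X0 by exact: measurable_within_comp_borel cSZ mQ DQ.
have mflow : measurable_fun setT (flow_map phiP a b : borel (tangent M) -> borel (curve M a b)).
  by apply: (@continuous_borel (tangent M) (curve M a b)); exact: flow_map_continuous.
pose X : {mfun measurableTypeR R >-> borel (tangent M)} :=
  HB.pack X0 (isMeasurableFun.Build _ _ _ _ _ mX0).
have mY0 : measurable_fun setT ((flow_map phiP a b : borel (tangent M) -> borel (curve M a b)) \o X0).
  exact: measurableT_comp.
pose Y : {mfun measurableTypeR R >-> borel (curve M a b)} :=
  HB.pack ((flow_map phiP a b : borel (tangent M) -> borel (curve M a b)) \o X0)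
    (isMeasurableFun.Build _ _ _ _ _ mY0).
exists s, (distribution (uniform_prob (@ltr01 R)) Y); split => //.
- move=> f cf [B fB].
  have mf := continuous_borelR cf.
  rewrite integral_distribution_uniform; last exact/measurable_EFinP.
  have cfS : {within DZ, continuous (fun t => f (flow_map phiP a b (S t)))}.
    move=> t; apply: (@continuous_comp _ _ _ (S : subspace DZ -> tangent M)
      (fun z => f (flow_map phiP a b z))); first exact: cSZ.
    apply: continuous_comp; last exact: cf.
    exact: flow_map_continuous.
  have := Qcvg _ B cfS (fun t => fB _).
  apply: cvg_trans; apply: near_eq_cvg; apply: nearW => k.
  rewrite integral_empirical //; congr (_ * _)%:E.
  by apply: eq_bigr => i _; rewrite gz (xP _ i).2.
- split; first exact: mG.
  transitivity (uniform_prob (@ltr01 R) setT); last exact: probability_setT.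
  congr (uniform_prob _ _); apply/seteqP; split => // t _.
  rewrite /= (extremals_between_flow phiP ltab).
  by exists (S (Q t)) => //; have [] := DQ t.
- by exists (distribution (uniform_prob (@ltr01 R)) X) => A mA.
Qed.
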